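(* Every 4-edge-connected graph with at most seven 5-edge-cuts admits a nowhere-zero 3-flow.
   Context: Graphs are finite and loopless, but may have multiple edges. A graph $G$ is $k$-edge-connected if $G-S$ is connected for each edge set $S$ with $|S|<k$. For $X\subset V(G)$, $\partial_G(X)$ denotes the set of edges of $G$ with one end in $X$ and the other in $V(G)\setminus X$; an edge set of the form $C=\partial_G(X)$ is a $k$-edge-cut if $|C|=k$. Edge-cuts are counted as edge sets. For an orientation $D$ of $E(G)$ and a vertex $v$, $\partial_D^+(v)$ (resp. $\partial_D^-(v)$) is the set of arcs with tail (resp. head) $v$. A graph $G$ admits a nowhere-zero 3-flow if there are an orientation $D$ of $E(G)$ and a function $f:E(G)\to\{\pm1,\pm2\}$ such that $\sum_{e\in\partial_D^+(v)}f(e)=\sum_{e\in\partial_D^-(v)}f(e)$ for every $v\in V(G)$. *)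

(* Defs.v *)
From HB Require Import structures.
From mathcomp Require Import all_boot all_order all_algebra.

Set Implicit Arguments.
Unset Strict Implicit.
Unset Printing Implicit Defensive.

Import GRing.Theory.

(* Finite loopless multigraphs: edges form a type of their own, so distinct
   edges may share the same pair of ends; [card_ends] excludes loops. *)
Record mgraph := MGraph {
  vertex : finType;
  edge : finType;
  ends : edge -> {set vertex};
  card_ends : forall e, #|ends e| = 2
}.

Section MGraph.
Variable G : mgraph.

Definition adjacent : rel (vertex G) :=
  fun x y => [exists e : edge G, ends e == [set x; y]].

Definition connected : Prop := forall x y : vertex G, connect adjacent x y.

(* G - S keeps every vertex. *)
Definition del_edges (S : {set edge G}) : mgraph :=
  @MGraph (vertex G) {e : edge G | e \notin S}
          (fun e => ends (val e)) (fun e => card_ends (val e)).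

Definition boundary (X : {set vertex G}) : {set edge G} :=
  [set e | [exists x in X, exists y in ~: X, ends e == [set x; y]]].

Definition edge_cuts (k : nat) : {set {set edge G}} :=
  [set C : {set edge G} |
     [exists X : {set vertex G}, C == boundary X] && (#|C| == k)].

Record orientation := Orientation {
  tail : edge G -> vertex G;
  head : edge G -> vertex G;
  ends_orientation : forall e, ends e = [set tail e; head e]
}.

Definition out_arcs (D : orientation) (v : vertex G) : {set edge G} :=
  [set e | tail D e == v].

Definition in_arcs (D : orientation) (v : vertex G) : {set edge G} :=
  [set e | head D e == v].

Local Open Scope ring_scope.

Definition nowhere_zero_3flow : Prop :=
  exists (D : orientation) (f : edge G -> int),
    (forall e, f e \in [:: 1; -1; 2; -2]) /\
    (forall v, \sum_(e in out_arcs D v) f e = \sum_(e in in_arcs D v) f e).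

End MGraph.

Definition edge_connected (k : nat) (G : mgraph) : Prop :=
  forall S : {set edge G}, #|S| < k -> connected (del_edges S).

(* Main.v *)
From mathcomp Require Import all_boot all_order all_algebra zify ring.
Require Import Defs.

(** The proof rests on the theorem of Lovász, Thomassen, Wu and Zhang on
    extending a pre-orientation of the arcs at one root vertex z0 to an
    orientation of the whole graph whose outdegree minus indegree is prescribed
    modulo 3 at every vertex. Each prescribed value is combined with the parity
    of the degree into a residue t modulo 6, additive over vertex sets, and the
    theorem holds as soon as every vertex set A avoiding z0, other than the
    complement of z0, is joined to its complement by at least 4 + |t(A)| edges,
    while z0 has degree at most 4 + |t(z0)|; here |t| is the distance from t to 6Z. It is
    [mod3_orientation] below.

    How it gives the result. Attach a new vertex z0 to the graph by seven
    edges, five leaving z0 and two entering it, and ask the original edges to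
    balance modulo 3. Then |t(z0)| = 3, so degree 7 is allowed at z0. A set A
    that receives k of the seven edges has boundary d(A) + k, and a short
    computation ([marked_ample]) shows that the condition on A holds when
    d(A) >= 4, except when d(A) = 5 and k = 0. So the seven ends must meet both
    sides of every 5-edge-cut. Seven vertices suffice for at most seven cuts
    ([hitting_marks]): fix a vertex r and look at the sides that avoid r, one
    for each cut. If there are at most six of them, take r and one vertex in
    each. If two of the seven meet, one common vertex serves both and leaves
    room for r. If the seven are pairwise disjoint, one vertex in each is
    enough, since the complement of one of them contains all the others.
    Vertices are repeated if fewer than seven arise.
    Finally, signs that balance modulo 3 become an integer flow with values
    1, -1, 2, -2 ([integer_flow]) by Tutte's argument: pushing three units along
    an arc of positive value keeps the value in this range, and paths of such
    pushes cancel the excesses.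

    How [mod3_orientation] is proved. A minimal counterexample has no loop and
    no parallel edges away from z0 (contract the parallel pair: two edges
    realize every residue modulo 3), and no set of at least two vertices is
    tight (contract it, orient, then orient its inside with the rest contracted
    to the new root). Hence all large sets have two edges to spare, and small
    modifications only have to be checked at single vertices. A vertex of
    degree 4 with t = 0 can be split off in two pairs. Every other vertex
    tolerates the deletion of an edge when it is oriented in one of the two
    directions, and an edge whose ends tolerate complementary directions can be
    deleted. By connectivity, up to reversing all signs, all vertices then have
    t = 1 or 2 and degree exactly 4 + t. Now an arc into z0 can be deleted; if
    there are no arcs at z0, any vertex can become the new root; and otherwise
    one arc from z0 to x is replaced by two arcs from x to z0, the same modulo
    3, which lets an edge from a neighbour to x be deleted. *)

Set Implicit Arguments.
Unset Strict Implicit.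
Unset Printing Implicit Defensive.

Import Order.TTheory GRing.Theory Num.Theory.

Local Open Scope ring_scope.

(** * Rooted orientation problems *)

Definition dist6 (t : int) : nat := minn `|(t %% 6)%Z| `|((- t) %% 6)%Z|.

(** The condition of the extension theorem on a vertex set with [d] boundary edges
    and total residue [t]. *)
Definition ample (d : nat) (t : int) : bool :=
  (4 + dist6 t <= d)%N && (2 %| d%:Z - t)%Z.

Lemma dvdz_sum (I : finType) (P : pred I) (d : int) (F : I -> int) :
  (forall i, P i -> (d %| F i)%Z) -> (d %| \sum_(i | P i) F i)%Z.
Proof.
move=> h; elim/big_ind: _ => [|x y hx hy|i /h//]; first exact: dvdz0.
by rewrite rpredD.
Qed.

Lemma sum_natz (I : finType) (P : pred I) (F : I -> nat) :
  (\sum_(i | P i) F i)%N%:Z = \sum_(i | P i) (F i)%:Z.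
Proof. by elim/big_rec2: _ => // i y x _ <-; rewrite PoszD. Qed.

Lemma sum_eq1 (I : finType) (A : {set I}) (u : I) :
  (\sum_(x in A) (u == x))%N = (u \in A).
Proof.
case: (boolP (u \in A)) => uA.
  rewrite (bigD1 u) //= eqxx big1 ?addn0 // => x /andP[_ xu].
  by rewrite eq_sym (negbTE xu).
rewrite big1 // => x xA; case: eqP => // ux; by rewrite ux xA in uA.
Qed.

Section Instances.
Variables T E : finType.
Implicit Types (en : E -> T * T) (S : {set E}) (V A B : {set T}) (e : E).
Implicit Types (a b : T -> nat) (t g : T -> int) (s : E -> int).
Implicit Types phi : T -> T.

Definition inc en e x : int := ((en e).1 == x)%:Z - ((en e).2 == x)%:Z.

Definition crosses en A e : bool := ((en e).1 \in A) (+) ((en e).2 \in A).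

Definition cut en S A : nat := \sum_(e in S) crosses en A e.

(** A value 1 keeps the direction given by the pair of ends, -1 reverses it. *)
Definition signs s : Prop := forall e, s e = 1 \/ s e = -1.

Definition net en S s x : int := \sum_(e in S) s e * inc en e x.

Definition orientable en S V g : Prop :=
  exists2 s, signs s & forall x, x \in V -> (3 %| net en S s x - g x)%Z.

(** An instance of the extension theorem, with the root z0 kept out of the vertex
    type: [a x] arcs run from z0 to [x], [b x] arcs from [x] to z0. The value
    [t x], which matters only modulo 6, prescribes outdegree minus indegree at
    [x], counting the arcs at z0; its residue modulo 2 is the parity of the
    degree ([valid_cut] for singletons). So the edges of [S] have to contribute [t x + a x - b x], and the
    residue at z0 is the opposite of the sum of [t]. Vertices outside [V] and
    edges outside [S] are discarded, which lets all reductions stay within the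
    same two finite types; loops are harmless and arise by contraction. *)
Record valid en S V a b t : Prop := Valid {
  valid_ends : forall e, e \in S -> (en e).1 \in V /\ (en e).2 \in V;
  valid_sum : (6 %| \sum_(x in V) (t x + (a x)%:Z - (b x)%:Z))%Z;
  valid_cut : forall A, A != set0 -> A \proper V ->
    ample (cut en S A + \sum_(x in A) (a x + b x)) (\sum_(x in A) t x);
  valid_root : (\sum_(x in V) (a x + b x) <= 4 + dist6 (\sum_(x in V) t x))%N
}.

(** The weight 8 makes the loss of one edge or vertex outweigh any change in the
    number of arcs at the root, which never exceeds 7. *)
Definition size_of S V a b : nat :=
  8 * (#|S| + #|V|) + \sum_(x in V) (a x + b x).

Definition solvable_below n : Prop := forall en S V a b t,
  valid en S V a b t -> (size_of S V a b < n)%N ->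
  orientable en S V (fun x => t x + (a x)%:Z - (b x)%:Z).

Lemma sum_inc en e A :
  \sum_(x in A) inc en e x = ((en e).1 \in A)%:Z - ((en e).2 \in A)%:Z.
Proof. by rewrite /inc sumrB -!sum_natz !sum_eq1. Qed.

Lemma sum_net en S s A : \sum_(x in A) net en S s x =
  \sum_(e in S) s e * (((en e).1 \in A)%:Z - ((en e).2 \in A)%:Z).
Proof.
rewrite exchange_big /=; apply: eq_bigr => e _.
by rewrite -mulr_sumr sum_inc.
Qed.

(** Up to signs, both sides count the edges leaving [A]. *)
Lemma net_parity en S s A : signs s ->
  (2 %| \sum_(x in A) net en S s x - (cut en S A)%:Z)%Z.
Proof.
move=> hs; rewrite sum_net /cut sum_natz -sumrB; apply: dvdz_sum => e _.
by rewrite /crosses; case: (hs e) => ->; case: (_ \in A); case: (_ \in A).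
Qed.

Lemma net_D1 en S s x e : e \in S ->
  net en S s x = s e * inc en e x + net en (S :\ e) s x.
Proof. exact: big_setD1. Qed.

Lemma cut_D1 en S A e : e \in S ->
  cut en S A = (crosses en A e + cut en (S :\ e) A)%N.
Proof. exact: big_setD1. Qed.

Lemma eq_net en en' S s s' x :
  (forall e, e \in S -> s e * inc en e x = s' e * inc en' e x) ->
  net en S s x = net en' S s' x.
Proof. by move=> h; apply: eq_bigr. Qed.

Lemma cutC en S V A : (forall e, e \in S -> (en e).1 \in V /\ (en e).2 \in V) ->
  cut en S (V :\: A) = cut en S A.
Proof.
move=> h; apply: eq_bigr => e /h[h1 h2]; rewrite /crosses !inE h1 h2 !andbT.
by case: (_ \in A); case: (_ \in A).
Qed.

Lemma orient_congr en S V g g' :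
  (forall x, x \in V -> (3 %| g' x - g x)%Z) ->
  orientable en S V g' -> orientable en S V g.
Proof.
move=> h [s hs ho]; exists s => // x xV.
have := ho x xV; have := h x xV; lia.
Qed.

Lemma orient_insert en S V g g' e eps : e \in S -> eps = 1 \/ eps = -1 ->
  (forall x, x \in V -> (3 %| g x - eps * inc en e x - g' x)%Z) ->
  orientable en (S :\ e) V g' -> orientable en S V g.
Proof.
move=> eS heps hg [s hs ho].
exists (fun f => if f == e then eps else s f).
  by move=> f; case: ifP.
move=> x xV; rewrite (net_D1 _ _ _ eS) eqxx.
have -> : net en (S :\ e) (fun f => if f == e then eps else s f) x =
          net en (S :\ e) s x.
  by apply: eq_net => f; rewrite !inE => /andP[/negbTE -> _].
have := ho x xV; have := hg x xV.
set p := eps * _; lia.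
Qed.

Lemma orient_opp en S V g :
  orientable en S V (fun x => - g x) -> orientable en S V g.
Proof.
case=> s hs ho; exists (fun e => - s e) => [e|x xV].
  by case: (hs e) => ->; [right|left].
have -> : net en S (fun e => - s e) x = - net en S s x.
  by rewrite /net -sumrN; apply: eq_bigr => e _; rewrite mulNr.
have := ho x xV; lia.
Qed.

Lemma orient_isolated en S V g x :
  (forall e, e \in S -> inc en e x = 0) -> (3 %| g x)%Z ->
  orientable en S (V :\ x) g -> orientable en S V g.
Proof.
move=> hx gx [s hs ho]; exists s => // y yV.
case: (eqVneq y x) => [->|yx]; last by apply: ho; rewrite !inE yx.
rewrite /net big1 => [|e /hx ->]; last by rewrite mulr0.
by rewrite sub0r rpredN.
Qed.

Definition split_off en e1 y1 y2 : E -> T * T :=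
  fun e => if e == e1 then (y1, y2) else en e.

(** An orientation of the new edge from [y1] to [y2] is carried back to the path
    through [x], where it enters and leaves once. *)
Lemma orient_split en S V g e1 e2 x y1 y2 i1 i2 :
  e1 \in S -> e2 \in S -> e1 != e2 -> i1 = 1 \/ i1 = -1 -> i2 = 1 \/ i2 = -1 ->
  (forall v, inc en e1 v = i1 * ((x == v)%:Z - (y1 == v)%:Z)) ->
  (forall v, inc en e2 v = i2 * ((x == v)%:Z - (y2 == v)%:Z)) ->
  orientable (split_off en e1 y1 y2) (S :\ e2) V g -> orientable en S V g.
Proof.
move=> e1S e2S e12 hi1 hi2 h1 h2 [s hs ho].
pose s' f := if f == e1 then - i1 * s e1 else if f == e2 then i2 * s e1 else s f.
exists s' => [f|v vV].
  rewrite /s'; case: ifP => _; first by case: hi1 => ->; case: (hs e1) => ->; lia.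
  by case: ifP => _ //; case: hi2 => ->; case: (hs e1) => ->; lia.
have e1S' : e1 \in S :\ e2 by rewrite !inE e12.
have := ho v vV.
rewrite (net_D1 _ _ _ e1S') (net_D1 _ _ _ e2S) (net_D1 _ _ _ e1S').
have -> : net en (S :\ e2 :\ e1) s' v =
          net (split_off en e1 y1 y2) (S :\ e2 :\ e1) s v.
  apply: eq_net => f; rewrite !inE /inc /split_off /s' => /and3P[f1 f2 _].
  by rewrite (negbTE f1) (negbTE f2).
rewrite h1 h2 /s' eqxx (eq_sym e2) (negbTE e12) eqxx /inc /split_off eqxx /=.
move: (x == v)%:Z (y1 == v)%:Z (y2 == v)%:Z (net _ _ _ _) (g v) => p q r k gv.
by case: hi1 => ->; case: hi2 => ->; case: (hs e1) => -> H;
  apply: etrans H; congr (_ %| _)%Z; ring.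
Qed.

Lemma cut_split en S A e1 e2 x y1 y2 :
  e1 \in S -> e2 \in S -> e1 != e2 -> x \notin A ->
  crosses en A e1 = (y1 \in A) -> crosses en A e2 = (y2 \in A) ->
  (cut (split_off en e1 y1 y2) (S :\ e2) A + ((y1 \in A) + (y2 \in A)) =
   cut en S A + ((y1 \in A) (+) (y2 \in A)))%N.
Proof.
move=> e1S e2S e12 xA h1 h2.
have e1S' : e1 \in S :\ e2 by rewrite !inE e12.
rewrite (cut_D1 _ _ e1S') (cut_D1 _ _ e2S) (cut_D1 _ _ e1S') h1 h2.
have -> : cut (split_off en e1 y1 y2) (S :\ e2 :\ e1) A = cut en (S :\ e2 :\ e1) A.
  apply: eq_bigr => f; rewrite !inE /crosses /split_off => /and3P[f1 _ _].
  by rewrite (negbTE f1).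
rewrite /crosses /split_off eqxx /=; case: (y1 \in A); case: (y2 \in A) => /=; lia.
Qed.

(** No edge is discarded: those inside a fibre become loops. *)
Definition contract (phi : T -> T) en : E -> T * T :=
  fun e => (phi (en e).1, phi (en e).2).

Definition fibre_sumn (phi : T -> T) V a : T -> nat :=
  fun y => (\sum_(x in V | phi x == y) a x)%N.

Definition fibre_sumz (phi : T -> T) V t : T -> int :=
  fun y => \sum_(x in V | phi x == y) t x.

Lemma fibre_sumnE phi V a B :
  (\sum_(y in B) fibre_sumn phi V a y = \sum_(x in V :&: phi @^-1: B) a x)%N.
Proof.
rewrite [RHS](partition_big phi (mem B)) => [|x]; last by rewrite !inE => /andP[].
apply: eq_bigr => y yB; apply: eq_bigl => x; rewrite !inE.
by case: eqP => [->|_]; rewrite ?andbF // !andbT; case: (x \in V) => //=; rewrite yB.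
Qed.

Lemma fibre_sumzE phi V t B :
  \sum_(y in B) fibre_sumz phi V t y = \sum_(x in V :&: phi @^-1: B) t x.
Proof.
rewrite [RHS](partition_big phi (mem B)) => [|x]; last by rewrite !inE => /andP[].
apply: eq_bigr => y yB; apply: eq_bigl => x; rewrite !inE.
by case: eqP => [->|_]; rewrite ?andbF // !andbT; case: (x \in V) => //=; rewrite yB.
Qed.

Lemma fibre_cE phi V a b B :
  (\sum_(y in B) (fibre_sumn phi V a y + fibre_sumn phi V b y) =
   \sum_(x in V :&: phi @^-1: B) (a x + b x))%N.
Proof. by rewrite !big_split /= !fibre_sumnE. Qed.

Lemma preim_imset_full phi V : V :&: phi @^-1: (phi @: V) = V.
Proof.
by apply/setP => x; rewrite !inE andb_idr // => xV; apply: imset_f.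
Qed.

(** Vertex sets of the contraction correspond to unions of fibres, and boundaries,
    arcs and residues add up over fibres. So no condition is new. *)
Lemma valid_contract phi en S V a b t : valid en S V a b t ->
  valid (contract phi en) S (phi @: V) (fibre_sumn phi V a) (fibre_sumn phi V b)
    (fibre_sumz phi V t).
Proof.
case=> h1 h2 h3 h4; split.
- by move=> e /h1[? ?]; split; apply: imset_f.
- rewrite sumrB big_split /= -!sum_natz !fibre_sumnE fibre_sumzE preim_imset_full.
  by rewrite !sum_natz -big_split -sumrB.
- move=> B B0 BV; have Bs := proper_sub BV.
  have hB : V :&: phi @^-1: B != set0.
    case/set0Pn: B0 => y yB; have /imsetP[x xV yx] := subsetP Bs _ yB.
    by apply/set0Pn; exists x; rewrite !inE xV -yx.
  have hB' : V :&: phi @^-1: B \proper V.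
    rewrite properE subsetIl /=; case/properP: BV => _ [y /imsetP[x xV ->] yB].
    by apply/subsetPn; exists x; rewrite // !inE xV.
  rewrite fibre_cE fibre_sumzE.
  have -> : cut (contract phi en) S B = cut en S (V :&: phi @^-1: B).
    by apply: eq_bigr => e /h1[p q]; rewrite /crosses !inE p q.
  exact: h3.
- by rewrite fibre_cE fibre_sumzE preim_imset_full.
Qed.

(** Contracting the outside of [A] into the root. The edges that leave [A] keep the
    signs [s1] and become arcs at the new root; subsets of [A] keep their
    boundary, and the new root has as many arcs as [A] has boundary edges, so
    only the bound on this number and the total residue need to be checked. *)
Lemma restrict en S V a b t A s1 :
  solvable_below (size_of S V a b) -> valid en S V a b t -> signs s1 ->
  A \proper V ->
  (cut en S A + \sum_(x in A) (a x + b x) <= 4 + dist6 (\sum_(x in A) t x))%N ->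
  (6 %| \sum_(x in A) (t x + (a x)%:Z - (b x)%:Z - net en S s1 x))%Z ->
  exists s, [/\ signs s,
    forall e, ~~ (((en e).1 \in A) && ((en e).2 \in A)) -> s e = s1 e &
    forall x, x \in A -> (3 %| net en S s x - (t x + (a x)%:Z - (b x)%:Z))%Z].
Proof.
move=> IH hv hs1 AV hroot hsum.
case: (hv) => h1 h2 h3 h4.
pose inA e := ((en e).1 \in A) && ((en e).2 \in A).
pose S' := [set e in S | inA e].
(* Edges leaving [A] become root arcs, directed by [s1]. *)
pose a' x := (a x + \sum_(e in S :\: S') (s1 e * inc en e x == -1)%R)%N.
pose b' x := (b x + \sum_(e in S :\: S') (s1 e * inc en e x == 1)%R)%N.
have notin_e e : e \in S :\: S' -> ~~ inA e.
  by rewrite !inE; case: (e \in S); rewrite ?andbT ?andbF.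
have netsplit s x : net en S s x = net en S' s x + net en (S :\: S') s x.
  rewrite /net (big_setID S') /=; congr (_ + _); apply: eq_bigl => e.
  by rewrite !inE; case: (e \in S).
have diff x : x \in A ->
    (a' x)%:Z - (b' x)%:Z = (a x)%:Z - (b x)%:Z - net en (S :\: S') s1 x.
  move=> xA.
  have -> : net en (S :\: S') s1 x =
    (\sum_(e in S :\: S') (s1 e * inc en e x == 1)%R)%N%:Z -
    (\sum_(e in S :\: S') (s1 e * inc en e x == -1)%R)%N%:Z.
    rewrite !sum_natz -sumrB; apply: eq_bigr => e _; rewrite /inc.
    by case: (hs1 e) => ->; case: (_ == x); case: (_ == x).
  rewrite /a' /b'; lia.
have tot B : B \subset A ->
  (cut en S' B + \sum_(x in B) (a' x + b' x) = cut en S B + \sum_(x in B) (a x + b x))%N.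
  move=> BA.
  have -> : (cut en S B = cut en S' B + cut en (S :\: S') B)%N.
    rewrite /cut (big_setID S') /=; congr (_ + _)%N; apply: eq_bigl => e.
    by rewrite !inE; case: (e \in S).
  have -> : (\sum_(x in B) (a' x + b' x) = \sum_(x in B) (a x + b x) +
     \sum_(x in B) \sum_(e in S :\: S') (((en e).1 == x) + ((en e).2 == x)))%N.
    rewrite -big_split; apply: eq_bigr => x xB; rewrite /a' /b' /=.
    rewrite addnACA -big_split; congr (_ + _)%N; apply: eq_bigr => e /notin_e /=.
    have xA := subsetP BA _ xB; rewrite /inA /inc.
    by case: (hs1 e) => ->; case: ((en e).1 =P x) => [->|_];
      case: ((en e).2 =P x) => [->|_] //=; rewrite ?xA.
  rewrite exchange_big /=.
  have -> : (\sum_(e in S :\: S') \sum_(x in B) (((en e).1 == x) + ((en e).2 == x))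
     = cut en (S :\: S') B)%N.
    apply: eq_bigr => e /notin_e; rewrite big_split /= !sum_eq1 /crosses /inA.
    move: (subsetP BA (en e).1) (subsetP BA (en e).2).
    by case: ((en e).1 \in B); case: ((en e).2 \in B) => //= /(_ isT) -> /(_ isT) ->.
  lia.
have cutA : cut en S' A = 0%N.
  by apply: big1 => e; rewrite inE /inA /crosses => /and3P[_ -> ->].
have hv' : valid en S' A a' b' t.
  split.
  - by move=> e; rewrite inE => /and3P[_].
  - rewrite (eq_bigr (fun x => t x + (a x)%:Z - (b x)%:Z - net en S s1 x +
       net en S' s1 x)); last first.
      by move=> x xA; rewrite netsplit -addrA (diff x xA); lia.
    rewrite big_split /= rpredD // sum_net big1 // => e.
    by rewrite inE /inA => /and3P[_ -> ->]; rewrite subrr mulr0.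
  - move=> B B0 BA; rewrite tot ?proper_sub //; apply: h3 => //.
    exact: proper_trans BA AV.
  - by have := tot A (subxx _); rewrite cutA add0n => ->.
have [|s2 hs2 ho2] := IH _ _ _ _ _ _ hv'.
  have hcA : (\sum_(x in A) (a' x + b' x) <= 7)%N.
    by have := valid_root hv'; rewrite /dist6; lia.
  have h5 : (#|S'| <= #|S|)%N by apply/subset_leq_card/subsetP => e; rewrite inE => /andP[].
  have h6 := proper_card AV.
  rewrite /size_of; lia.
exists (fun e => if inA e then s2 e else s1 e); split.
- by move=> e; case: ifP.
- by move=> e; rewrite /inA => /negbTE ->.
move=> x xA; rewrite netsplit.
have -> : net en S' (fun e => if inA e then s2 e else s1 e) x = net en S' s2 x.
  by apply: eq_net => e; rewrite inE => /andP[_ ->].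
have -> : net en (S :\: S') (fun e => if inA e then s2 e else s1 e) x =
  net en (S :\: S') s1 x by apply: eq_net => e /notin_e /negbTE ->.
have := ho2 x xA; have := diff x xA; lia.
Qed.

End Instances.

(** * Loops, parallel edges and tight sets *)

Lemma merge_parity (t n : int) (a b c : nat) :
  (3 %| t + a%:Z - b%:Z - n)%Z -> (2 %| n - c%:Z)%Z ->
  (2 %| (c + (a + b))%N%:Z - t)%Z -> (6 %| t + a%:Z - b%:Z - n)%Z.
Proof. lia. Qed.

Lemma ample_tight (d : nat) (t : int) :
  (d <= 5 + dist6 t)%N -> (2 %| d%:Z - t)%Z -> (d <= 4 + dist6 t)%N.
Proof. rewrite /dist6; lia. Qed.

(** Two parallel edges contribute -2, 0 or 2, that is, every residue modulo 3. *)
Lemma two_signs_mod3 (i r : int) : i = 1 \/ i = -1 ->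
  exists p q, [/\ p = 1 \/ p = -1, q = 1 \/ q = -1 & (3 %| p + q * i + r)%Z].
Proof.
move=> hi; have [h|[h|h]] : (3 %| r)%Z \/ (3 %| r + 2)%Z \/ (3 %| r - 2)%Z by lia.
- by exists 1, (- i); split; [lia|lia|]; case: hi => ->; apply: etrans h; congr dvdz; ring.
- by exists 1, i; split; [lia|lia|]; case: hi => ->; apply: etrans h; congr dvdz; ring.
- by exists (-1), (- i); split; [lia|lia|]; case: hi => ->; apply: etrans h; congr dvdz; ring.
Qed.

Section Reductions.
Variables T E : finType.
Implicit Types (en : E -> T * T) (S : {set E}) (V A B : {set T}) (e : E).
Implicit Types (a b : T -> nat) (t g : T -> int) (s : E -> int).
Implicit Types phi : T -> T.

Lemma root_le7 en S V a b t :
  valid en S V a b t -> (\sum_(x in V) (a x + b x) <= 7)%N.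
Proof. by case=> _ _ _; rewrite /dist6; lia. Qed.

Lemma net_loops en S s x :
  (forall e, e \in S -> (en e).1 = (en e).2) -> net en S s x = 0.
Proof. by move=> h; apply: big1 => e /h; rewrite /inc => ->; rewrite subrr mulr0. Qed.

(** With a single vertex besides the root, every edge is a loop and the only
    condition is the one on the total residue. *)
Lemma orient_small en S V a b t : (#|V| <= 1)%N -> valid en S V a b t ->
  orientable en S V (fun x => t x + (a x)%:Z - (b x)%:Z).
Proof.
move=> hV [h1 h2 _ _]; exists (fun=> 1) => [e|x xV]; first by left.
have eqx y : y \in V -> y = x by move=> yV; apply: (card_le1_eqP hV).
rewrite net_loops => [|e /h1[/eqx -> /eqx ->]//].
move: h2; rewrite (bigD1 x) //= big1 => [|y /andP[/eqx ->]]; last by rewrite eqxx.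
lia.
Qed.

Lemma reduce_loop en S V a b t e :
  solvable_below T E (size_of S V a b) -> valid en S V a b t ->
  e \in S -> (en e).1 = (en e).2 ->
  orientable en S V (fun x => t x + (a x)%:Z - (b x)%:Z).
Proof.
move=> IH [h1 h2 h3 h4] eS loop.
have cutE A : cut en (S :\ e) A = cut en S A.
  by rewrite (cut_D1 _ _ eS) /crosses loop addbb.
apply: (@orient_insert _ _ _ _ _ _ (fun x => t x + (a x)%:Z - (b x)%:Z) e 1) => //.
- by left.
- by move=> x _; rewrite /inc loop; lia.
apply: IH; last by rewrite /size_of (cardsD1 e S) eS; lia.
split=> //; first by move=> f /setD1P[_ /h1].
by move=> A A0 AV; rewrite cutE; apply: h3.
Qed.

Lemma card_contract phi V y z :
  y \in V -> z \in V -> y != z -> phi y = phi z -> (#|phi @: V| < #|V|)%N.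
Proof.
move=> yV zV yz pyz; rewrite ltn_neqAle leq_imset_card andbT.
by apply/imset_injP => inj; rewrite (inj _ _ yV zV pyz) eqxx in yz.
Qed.

Lemma orient_contract phi en S V a b t y z :
  solvable_below T E (size_of S V a b) -> valid en S V a b t ->
  y \in V -> z \in V -> y != z -> phi y = phi z ->
  orientable (contract phi en) S (phi @: V)
    (fun x => fibre_sumz phi V t x + (fibre_sumn phi V a x)%:Z -
              (fibre_sumn phi V b x)%:Z).
Proof.
move=> IH hv yV zV yz pyz; apply: IH; first exact: valid_contract.
rewrite /size_of fibre_cE preim_imset_full.
have := card_contract yV zV yz pyz; lia.
Qed.

(** The vertex [a0] is meant to be a member of [A]. *)
Definition collapse A (a0 : T) : T -> T := fun u => if u \in A then a0 else u.

Lemma collapse_eq A (a0 : T) u x : a0 \in A -> x \notin A ->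
  (collapse A a0 u == x) = (u == x).
Proof.
move=> a0A xA; rewrite /collapse; case: ifP => // uA.
by rewrite (negbTE (memPn xA _ a0A)) (negbTE (memPn xA _ uA)).
Qed.

Lemma collapse_eq0 A (a0 : T) u : a0 \in A -> (collapse A a0 u == a0) = (u \in A).
Proof.
move=> a0A; rewrite /collapse; case: ifPn => [_|uA]; first by rewrite eqxx.
by apply: contraNF uA => /eqP ->.
Qed.

Section Collapse.
Variables (A V : {set T}) (a0 : T).
Hypotheses (a0A : a0 \in A) (AV : A \subset V).

Lemma inc_collapse_out en e x : x \notin A ->
  inc (contract (collapse A a0) en) e x = inc en e x.
Proof. by move=> xA; rewrite /inc !collapse_eq. Qed.

Lemma inc_collapse_in en e :
  inc (contract (collapse A a0) en) e a0 = ((en e).1 \in A)%:Z - ((en e).2 \in A)%:Z.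
Proof. by rewrite /inc /= !collapse_eq0. Qed.

Lemma fibre_in (R : nmodType) (F : T -> R) :
  \sum_(x in V | collapse A a0 x == a0) F x = \sum_(x in A) F x.
Proof.
apply: eq_bigl => x; rewrite collapse_eq0 // andb_idl //; exact: (subsetP AV).
Qed.

Lemma fibre_out (R : nmodType) (F : T -> R) x : x \in V -> x \notin A ->
  \sum_(y in V | collapse A a0 y == x) F y = F x.
Proof.
move=> xV xA; rewrite (eq_bigl (pred1 x)) ?big_pred1_eq // => y /=.
by rewrite collapse_eq // andb_idl // => /eqP ->.
Qed.

(** Signs of the contraction of [A], read on the original edges: they settle every
    vertex outside [A], whatever is later chosen inside [A], and the vertices of
    [A] only jointly. *)
Lemma orient_collapse en S a b t :
  orientable (contract (collapse A a0) en) S (collapse A a0 @: V)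
    (fun x => fibre_sumz (collapse A a0) V t x +
              (fibre_sumn (collapse A a0) V a x)%:Z -
              (fibre_sumn (collapse A a0) V b x)%:Z) ->
  exists s, [/\ signs s,
    forall s' x, (forall e, ~~ (((en e).1 \in A) && ((en e).2 \in A)) -> s' e = s e) ->
      x \in V -> x \notin A ->
      (3 %| net en S s' x - (t x + (a x)%:Z - (b x)%:Z))%Z &
    (3 %| \sum_(x in A) (t x + (a x)%:Z - (b x)%:Z - net en S s x))%Z].
Proof.
case=> s hs ho; exists s; split=> // [s' x hs' xV xA|].
  have xV' : x \in collapse A a0 @: V.
    by apply/imsetP; exists x => //; rewrite /collapse (negbTE xA).
  have := ho x xV'; rewrite /fibre_sumz /fibre_sumn.
  rewrite (fibre_out t) ?(fibre_out a) ?(fibre_out b) //.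
  have -> // : net (contract (collapse A a0) en) S s x = net en S s' x.
  apply: eq_net => e _; rewrite inc_collapse_out //.
  have [/andP[p q]|/hs' ->//] := boolP (((en e).1 \in A) && ((en e).2 \in A)).
  by rewrite /inc (negbTE (memPn xA _ p)) (negbTE (memPn xA _ q)) !mulr0.
have a0V' : a0 \in collapse A a0 @: V.
  by apply/imsetP; exists a0; rewrite ?(subsetP AV) // /collapse a0A.
have := ho a0 a0V'; rewrite /fibre_sumz /fibre_sumn.
rewrite (fibre_in t) ?(fibre_in a) ?(fibre_in b) //.
have -> : net (contract (collapse A a0) en) S s a0 = \sum_(x in A) net en S s x.
  by rewrite sum_net; apply: eq_bigr => e _; rewrite inc_collapse_in.
rewrite !sumrB big_split /= -!sum_natz => h.
by rewrite -rpredN opprB.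
Qed.
End Collapse.

(** A set [A] whose boundary is as small as allowed can serve as the root of its own
    inside: contracting [A] yields signs on the boundary of [A], and they meet
    the degree bound that [restrict] asks for. *)
Lemma reduce_tight en S V a b t A :
  solvable_below T E (size_of S V a b) -> valid en S V a b t ->
  (1 < #|A|)%N -> A \proper V ->
  (cut en S A + \sum_(x in A) (a x + b x) <= 5 + dist6 (\sum_(x in A) t x))%N ->
  orientable en S V (fun x => t x + (a x)%:Z - (b x)%:Z).
Proof.
move=> IH hv A1 AV hcut.
have [a0 [a1 [a0A a1A a01]]] := card_gt1P A1.
have AsV := proper_sub AV.
have [|s1 [hs1 hout hin]] := orient_collapse a0A AsV
    (orient_contract (phi := collapse A a0) IH hv
      (subsetP AsV _ a0A) (subsetP AsV _ a1A) a01 _).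
  by rewrite /collapse a0A a1A.
have A0 : A != set0 by apply/set0Pn; exists a0.
have /andP[good1 good2] := valid_cut hv A0 AV.
have par := net_parity en S A hs1.
have [||s [hs hagree hA]] := restrict IH hv hs1 AV.
- exact: ample_tight hcut good2.
- by move: hin par good2; rewrite !sumrB !big_split /= -!sum_natz; apply: merge_parity.
exists s => // x xV; have [xA|xA] := boolP (x \in A); first exact: hA.
exact: hout.
Qed.

(** Contracting two parallel edges leaves their signs free, and these correct the
    residue at one end; the other end follows from the joint condition. *)
Lemma reduce_parallel en S V a b t e1 e2 :
  solvable_below T E (size_of S V a b) -> valid en S V a b t ->
  e1 \in S -> e2 \in S -> e1 != e2 -> (en e1).1 != (en e1).2 ->
  (en e2 == en e1) || (en e2 == ((en e1).2, (en e1).1)) ->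
  orientable en S V (fun x => t x + (a x)%:Z - (b x)%:Z).
Proof.
move=> IH hv e1S e2S e12 nloop hpar.
have [xV yV] := valid_ends hv e1S.
pose x := (en e1).1; pose y := (en e1).2; pose A := [set x; y].
have xA : x \in A by rewrite !inE eqxx.
have yA : y \in A by rewrite !inE eqxx orbT.
have AV : A \subset V by apply/subsetP => z; rewrite !inE => /orP[] /eqP ->.
have [|s1 [hs1 hout hin]] := orient_collapse xA AV
    (orient_contract (phi := collapse A x) IH hv xV yV nloop _).
  by rewrite /collapse xA yA.
pose g z := t z + (a z)%:Z - (b z)%:Z.
have e2S' : e2 \in S :\ e1 by rewrite !inE eq_sym e12.
pose sg p q f : int := if f == e1 then p else if f == e2 then q else s1 f.
have neteq p q z : net en S (sg p q) z =
    p * inc en e1 z + (q * inc en e2 z + net en (S :\ e1 :\ e2) s1 z).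
  rewrite (net_D1 _ _ _ e1S) (net_D1 _ _ _ e2S') /sg !eqxx eq_sym (negbTE e12).
  do 2 congr (_ + _); apply: eq_net => f; rewrite !inE => /and3P[f2 f1 _].
  by rewrite (negbTE f1) (negbTE f2).
have i1x : inc en e1 x = 1 by rewrite /inc eqxx eq_sym (negbTE nloop).
have i2x : inc en e2 x = 1 \/ inc en e2 x = -1.
  by case/orP: hpar => /eqP; rewrite /inc => -> /=; rewrite eqxx ?(eq_sym (en e1).2)
    (negbTE nloop); [left|right].
have [p [q [hp hq hx]]] : exists p q, [/\ p = 1 \/ p = -1, q = 1 \/ q = -1 &
    (3 %| net en S (sg p q) x - g x)%Z].
  pose r := net en (S :\ e1 :\ e2) s1 x - g x.
  have red p q : net en S (sg p q) x - g x = p + q * inc en e2 x + r.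
    by rewrite neteq i1x /r mulr1; ring.
  suff [p [q [hp hq h]]] : exists p q, [/\ p = 1 \/ p = -1, q = 1 \/ q = -1 &
      (3 %| p + q * inc en e2 x + r)%Z].
    by exists p, q; rewrite red.
  exact: two_signs_mod3.
exists (sg p q) => [f|z zV]; first by rewrite /sg; do 2 case: ifP => _ //.
have inA2 : ((en e2).1 \in A) && ((en e2).2 \in A).
  by case/orP: hpar => /eqP -> /=; rewrite ?xA ?yA.
have [zA|zA] := boolP (z \in A); last first.
  apply: hout => // f; rewrite /sg; case: eqP => [->|_]; first by rewrite xA yA.
  by case: eqP => [->|_] //; rewrite inA2.
have hsum : (3 %| \sum_(w in A) (g w - net en S (sg p q) w))%Z.
  move: hin; rewrite sumrB [in X in _ -> X]sumrB !sum_net.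
  have -> // : \sum_(e in S) s1 e * (((en e).1 \in A)%:Z - ((en e).2 \in A)%:Z) =
    \sum_(e in S) sg p q e * (((en e).1 \in A)%:Z - ((en e).2 \in A)%:Z).
  apply: eq_bigr => f _; rewrite /sg; case: eqP => [->|_]; first by rewrite xA yA !mulr0.
  by case: eqP => [->|_] //; case/andP: inA2 => -> ->; rewrite !mulr0.
move: zA; rewrite !inE => /orP[] /eqP -> //.
move: hsum hx; rewrite big_setU1 /= ?inE // big_set1 -/y /g.
clear; lia.
Qed.

End Reductions.

(** * Deleting oriented edges and root arcs *)

Lemma dist6N t : dist6 (- t) = dist6 t.
Proof. by rewrite /dist6 opprK minnC. Qed.

Lemma ampleN d t : ample d (- t) = ample d t.
Proof. by rewrite /ample dist6N; congr andb; clear; lia. Qed.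

(** The booleans tell whether [A] contains the tail and the head of the edge that is
    removed. *)
Lemma ample_edge (p q : bool) (d : nat) (t eps : int) : eps = 1 \/ eps = -1 ->
  ample ((p (+) q) + d) t ->
  (p (+) q -> (5 + dist6 (t - eps * (p%:Z - q%:Z)) <= (p (+) q) + d)%N) ->
  ample d (t - eps * (p%:Z - q%:Z)).
Proof.
rewrite /ample => heps; case: p; case: q => /= /andP[h1 h2] h3; apply/andP;
  rewrite ?subrr ?mulr0 ?subr0 ?add0n // in h1 h2 h3 *;
  have := h3 isT; case: heps h2 h1 => ->; rewrite /dist6; clear; lia.
Qed.

Section Local.
Variables T E : finType.
Implicit Types (en : E -> T * T) (S : {set E}) (V A B : {set T}) (e : E).
Implicit Types (a b : T -> nat) (t g : T -> int) (s : E -> int).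

(** What the reductions of the previous part leave. The essential gain is that proper
    sets of two or more vertices have two boundary edges more than required, so
    that removing one edge or one arc can only hurt single vertices. *)
Record reduced en S V a b t : Prop := Reduced {
  reduced_valid : valid en S V a b t;
  reduced_V : (1 < #|V|)%N;
  reduced_loop : forall e, e \in S -> (en e).1 != (en e).2;
  reduced_simple : forall e1 e2, e1 \in S -> e2 \in S -> e1 != e2 ->
    ~~ ((en e2 == en e1) || (en e2 == ((en e1).2, (en e1).1)));
  reduced_big : forall A, (1 < #|A|)%N -> A \proper V ->
    (6 + dist6 (\sum_(x in A) t x)%R <= cut en S A + \sum_(x in A) (a x + b x))%N
}.

Definition deg en S a b x : nat := cut en S [set x] + (a x + b x).

Definition solvable en S V a b t : Prop :=
  orientable en S V (fun x => t x + (a x)%:Z - (b x)%:Z).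

Lemma valid_opp en S V a b t :
  valid en S V a b t -> valid en S V b a (fun x => - t x).
Proof.
have sw A : (\sum_(x in A) (b x + a x) = \sum_(x in A) (a x + b x))%N.
  by apply: eq_bigr => x _; rewrite addnC.
case=> h1 h2 h3 h4; split=> //.
- rewrite -rpredN -sumrN; apply: etrans h2; congr dvdz.
  by apply: eq_bigr => x _; ring.
- by move=> A A0 AV; rewrite sumrN ampleN sw; apply: h3.
- by rewrite sumrN dist6N sw.
Qed.

Lemma reduced_opp en S V a b t :
  reduced en S V a b t -> reduced en S V b a (fun x => - t x).
Proof.
case=> h1 h2 h3 h4 h5; split=> //; first exact: valid_opp.
move=> A A1 AV; have := h5 A A1 AV; rewrite sumrN dist6N.
by have -> // : (\sum_(x in A) (b x + a x) = \sum_(x in A) (a x + b x))%N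
  by apply: eq_bigr => x _; rewrite addnC.
Qed.

Lemma solvable_opp en S V a b t :
  solvable en S V b a (fun x => - t x) -> solvable en S V a b t.
Proof.
move=> h; apply: orient_opp; apply: orient_congr h => x _.
by rewrite (_ : _ - _ = 0) //; ring.
Qed.

Lemma size_opp S V a b : size_of S V b a = size_of S V a b.
Proof. by rewrite /size_of; congr (_ + _)%N; apply: eq_bigr => x _; rewrite addnC. Qed.

Lemma sum_replace t t' a b V : \sum_(x in V) t' x = \sum_(x in V) t x ->
  \sum_(x in V) (t' x + (a x)%:Z - (b x)%:Z) =
  \sum_(x in V) (t x + (a x)%:Z - (b x)%:Z).
Proof. by move=> h; rewrite !sumrB !big_split /= h. Qed.

Lemma set1_proper V x : (1 < #|V|)%N -> x \in V -> [set x] \proper V.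
Proof.
move=> V1 xV; rewrite properEcard sub1set xV cards1; exact: V1.
Qed.

Lemma ample_deg en S V a b t x : reduced en S V a b t -> x \in V ->
  ample (deg en S a b x) (t x).
Proof.
case=> h1 h2 _ _ _ xV; have x0 : [set x] != set0 by apply/set0Pn; exists x; rewrite inE.
by have := valid_cut h1 x0 (set1_proper h2 xV); rewrite !big_set1.
Qed.

Lemma setP1 A : A != set0 -> (exists x, A = [set x]) \/ (1 < #|A|)%N.
Proof.
rewrite -card_gt0 => A0; case: (ltnP 1 #|A|) => h; [by right|left].
by apply/cards1P; rewrite eqn_leq h A0.
Qed.

(** Fixing the direction of an edge and deleting it moves one unit of the boundary
    into the residue; only its two ends can become too small. *)
Lemma reduce_edge en S V a b t e eps :
  solvable_below T E (size_of S V a b) -> reduced en S V a b t ->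
  e \in S -> eps = 1 \/ eps = -1 ->
  (forall x, (x == (en e).1) || (x == (en e).2) ->
     (5 + dist6 (t x - eps * inc en e x)%R <= deg en S a b x)%N) ->
  solvable en S V a b t.
Proof.
move=> IH hr eS heps hacc; have hv := reduced_valid hr.
have [uV vV] := valid_ends hv eS.
pose t' x := t x - eps * inc en e x.
have sumt A : \sum_(x in A) t' x =
    \sum_(x in A) t x - eps * (((en e).1 \in A)%:Z - ((en e).2 \in A)%:Z).
  by rewrite sumrB -mulr_sumr sum_inc.
have sumtV : \sum_(x in V) t' x = \sum_(x in V) t x.
  by rewrite sumt uV vV subrr mulr0 subr0.
apply: (orient_insert (g' := fun x => t' x + (a x)%:Z - (b x)%:Z) eS heps).
  by move=> x _; rewrite (_ : _ - _ = 0) // /t'; ring.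
apply: IH; last by rewrite /size_of (cardsD1 e S) eS; clear; lia.
split.
- by move=> f /setD1P[_ /(valid_ends hv)].
- by rewrite (sum_replace _ _ sumtV); apply: valid_sum hv.
- move=> A A0 AV; rewrite sumt; apply: ample_edge => //.
    by have := valid_cut hv A0 AV; rewrite (cut_D1 _ _ eS) -addnA.
  rewrite addnA -(cut_D1 _ _ eS) => cr.
  have [[x Ax]|A1] := setP1 A0.
    move: cr; rewrite Ax !big_set1 !inE => cr.
    have := hacc x; rewrite /deg /inc !(eq_sym x); apply.
    by case: (_ == x) cr.
  have := reduced_big hr A1 AV; case: heps => ->; move: cr.
    by case: (_ \in A); case: (_ \in A) => //= _; rewrite /dist6; clear; lia.
  by case: (_ \in A); case: (_ \in A) => //= _; rewrite /dist6; clear; lia.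
- by rewrite sumtV; apply: valid_root hv.
Qed.

Lemma sum_predn a x A : (0 < a x)%N ->
  (\sum_(y in A) (a y - (x == y)) + (x \in A) = \sum_(y in A) a y)%N.
Proof.
move=> ax; rewrite -(sum_eq1 A x) -big_split; apply: eq_bigr => y _ /=.
by case: eqP => [<-|]; clear -ax; lia.
Qed.

Lemma sumz_shift t k x A :
  \sum_(y in A) (t y - k * (x == y)%:Z) = \sum_(y in A) t y - k * (x \in A)%:Z.
Proof. by rewrite sumrB -mulr_sumr -sum_natz sum_eq1. Qed.

(** Deleting an arc from [x] to the root is compensated by lowering [t x]. *)
Lemma reduce_in_arc en S V a b t x :
  solvable_below T E (size_of S V a b) -> reduced en S V a b t ->
  x \in V -> (0 < b x)%N -> (5 + dist6 (t x - 1)%R <= deg en S a b x)%N ->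
  solvable en S V a b t.
Proof.
move=> IH hr xV bx hacc; have hv := reduced_valid hr.
pose t' y := t y - 1 * (x == y)%:Z; pose b' y := (b y - (x == y))%N.
have hb A : (\sum_(y in A) (a y + b' y) + (x \in A) = \sum_(y in A) (a y + b y))%N.
  by rewrite !big_split /= -addnA sum_predn.
have hg y : t' y + (a y)%:Z - (b' y)%:Z = t y + (a y)%:Z - (b y)%:Z.
  by rewrite /t' /b'; case: eqP => [<-|_]; clear -bx; lia.
apply: (orient_congr (g' := fun y => t' y + (a y)%:Z - (b' y)%:Z)).
  by move=> y _; rewrite hg subrr.
have hbV := hb V; rewrite xV in hbV.
apply: IH; last by rewrite /size_of; move: hbV; clear; lia.
split.
- exact: valid_ends hv.
- by rewrite (eq_bigr _ (fun y _ => hg y)); apply: valid_sum hv.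
- move=> A A0 AV; rewrite sumz_shift; have := valid_cut hv A0 AV; rewrite -hb.
  have [[y Ay]|A1] := setP1 A0.
    rewrite Ay !big_set1 inE; case: eqP => [xy|_]; last by rewrite mulr0 subr0 addn0.
    move: hacc; rewrite /deg xy /b' -xy eqxx /ample /dist6; clear -bx; lia.
  have := reduced_big hr A1 AV; rewrite -hb; case: (x \in A); rewrite /ample /dist6; clear; lia.
- have := valid_root hv; rewrite sumz_shift -hb xV /dist6; clear; lia.
Qed.

(** Meaningful when [e] is incident with [x] and is not a loop. *)
Definition far en x e : T := if (en e).1 == x then (en e).2 else (en e).1.

Lemma farP en x e : crosses en [set x] e ->
  [/\ en e = (x, far en x e) \/ en e = (far en x e, x), far en x e != x,
      forall v, inc en e v = inc en e x * ((x == v)%:Z - (far en x e == v)%:Z),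
      inc en e x = 1 \/ inc en e x = -1 &
      forall A, crosses en A e = (x \in A) (+) (far en x e \in A)].
Proof.
rewrite /crosses /inc /far !inE; case: (en e) => u v /=.
have [->|ux] := eqVneq u x; have [->|vx] := eqVneq v x => //= _; split=> //.
- by left.
- by move=> w; rewrite mul1r.
- by left.
- by right.
- by move=> w; clear; lia.
- by right.
- by move=> A; rewrite addbC.
Qed.

Lemma cut1_card en S x : cut en S [set x] = #|[set e in S | crosses en [set x] e]|.
Proof.
rewrite -sum1_card /cut big_mkcond [RHS]big_mkcond /=; apply: eq_bigr => e _.
by rewrite inE; case: (e \in S); case: (crosses _ _ _).
Qed.

Lemma far_in en S V a b t x e : valid en S V a b t -> e \in S ->
  crosses en [set x] e -> far en x e \in V :\ x.
Proof.
move=> hv eS cr; have [h1 h2 _ _ _] := farP cr; have := valid_ends hv eS.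
by rewrite in_setD1 h2; case: h1 => -> /= [].
Qed.

Lemma far_inj en S V a b t x e f : reduced en S V a b t -> e \in S -> f \in S ->
  crosses en [set x] e -> crosses en [set x] f -> e != f ->
  far en x e != far en x f.
Proof.
move=> hr eS fS ce cf ef; have := reduced_simple hr eS fS ef.
apply: contraNneq => h; have [he _ _ _ _] := farP ce; have [hf _ _ _ _] := farP cf.
by case: he hf => -> [] ->; rewrite /= h ?eqxx ?orbT.
Qed.

Lemma avoid_ends en S V a b t x e : reduced en S V a b t -> e \in S ->
  ~~ crosses en [set x] e -> (en e).1 != x /\ (en e).2 != x.
Proof.
move=> hr eS; have := reduced_loop hr eS; rewrite /crosses !inE.
by have [->|//] := eqVneq (en e).1 x; rewrite eq_sym => /negbTE ->.
Qed.

(** Let c be the number of arcs between [x] and the root. The complement of [x] has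
    boundary deg(z0) + 4 - 2c, and its residue is that of z0 up to sign. Since
    deg(z0) is at most 4 + |t(z0)| while a set of two or more vertices has two
    edges to spare, c is at most 1. A complement with a single vertex only gives
    c <= 2, but then the at least two edges at [x] would be parallel. *)
Lemma split_root_deg en S V a b t x : reduced en S V a b t -> x \in V ->
  deg en S a b x = 4 -> dist6 (t x) = 0%N -> (a x + b x <= 1)%N.
Proof.
move=> hr xV hd ht; have hv := reduced_valid hr.
have hV := cardsD1 x V; rewrite xV in hV.
have V1 := reduced_V hr.
have pr : V :\ x \proper V by rewrite properD1.
have ne : V :\ x != set0 by rewrite -card_gt0; clear -hV V1; lia.
have hroot := valid_root hv.
have cE : cut en S (V :\ x) = cut en S [set x] := cutC _ (valid_ends hv).
rewrite !(big_setD1 x xV) /= in hroot.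
have [V2|V3] := leqP #|V :\ x| 1; last first.
  have := reduced_big hr V3 pr; rewrite cE.
  move: hd ht hroot; rewrite /deg.
  move: (\sum_(y in V :\ x) t y) (\sum_(y in V :\ x) (a y + b y))%N (cut _ _ _) (a x + b x)%N.
  rewrite /dist6; clear; lia.
have /andP[h _] := valid_cut hv ne pr.
have c2 : (a x + b x <= 2)%N.
  move: h; rewrite cE; move: hd ht hroot; rewrite /deg.
  move: (\sum_(y in V :\ x) t y) (\sum_(y in V :\ x) (a y + b y))%N (cut _ _ _) (a x + b x)%N.
  rewrite /dist6; clear; lia.
have : (1 < #|[set e in S | crosses en [set x] e]|)%N.
  by rewrite -cut1_card; move: c2 hd; rewrite /deg; clear; lia.
case/card_gt1P => e [f []]; rewrite !inE => /andP[eS ce] /andP[fS cf] ef.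
have := far_inj hr eS fS ce cf ef; case/eqP.
by apply: (card_le1_eqP V2); apply: far_in hv _ _.
Qed.

End Local.

(** * Splitting off a balanced vertex of degree four *)

Lemma dist6_shift u t : dist6 u = 0%N -> dist6 (u + t) = dist6 t.
Proof. rewrite /dist6; clear; lia. Qed.

Lemma ample_shift d u t : dist6 u = 0%N -> ample d (u + t) = ample d t.
Proof.
move=> hu; rewrite /ample dist6_shift //; congr andb.
move: hu; rewrite /dist6; clear; lia.
Qed.

Lemma set_seq (I : finType) (A : {set I}) n : #|A| = n ->
  exists r, [/\ uniq r, size r = n & A =i r].
Proof.
move=> <-; exists (enum A); rewrite enum_uniq -cardE; split=> // i.
by rewrite mem_enum.
Qed.

Section Splitting.
Variables T E : finType.
Implicit Types (en : E -> T * T) (S : {set E}) (V A B : {set T}) (e : E).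
Implicit Types (a b : T -> nat) (t g : T -> int) (s : E -> int).

Lemma split_off_neq en e1 y1 y2 e : e != e1 -> split_off en e1 y1 y2 e = en e.
Proof. by rewrite /split_off => /negbTE ->. Qed.

(** The four edges at [x] are split off in two pairs. A set [A] loses two boundary
    edges for each pair with both ends in [A]. One such pair is harmless, because
    [A] then has two members; if both pairs lie in [A], then the boundary that
    results is the one of [A] with [x] added. *)
Lemma reduce_split4 en S V a b t x :
  solvable_below T E (size_of S V a b) -> reduced en S V a b t ->
  x \in V -> deg en S a b x = 4 -> dist6 (t x) = 0%N -> (a x + b x = 0)%N ->
  solvable en S V a b t.
Proof.
move=> IH hr xV hd ht hc; have hv := reduced_valid hr.
have : #|[set e in S | crosses en [set x] e]| = 4.
  by rewrite -cut1_card; move: hd; rewrite /deg hc addn0.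
case/set_seq => -[|e1 [|e2 [|e3 [|e4 [|? ?]]]]] [] // ur _ mem.
move: (ur); rewrite /= !inE !negb_or -!andbA andbT.
case/and5P => e12 e13 e14 e23 /andP[e24 e34].
have memS e : e \in [:: e1; e2; e3; e4] -> e \in S /\ crosses en [set x] e.
  by rewrite -mem inE => /andP.
have /memS[e1S c1] : e1 \in [:: e1; e2; e3; e4] by rewrite !inE eqxx.
have /memS[e2S c2] : e2 \in [:: e1; e2; e3; e4] by rewrite !inE eqxx orbT.
have /memS[e3S c3] : e3 \in [:: e1; e2; e3; e4] by rewrite !inE eqxx !orbT.
have /memS[e4S c4] : e4 \in [:: e1; e2; e3; e4] by rewrite !inE eqxx !orbT.
have [_ n1 h1 i1 k1] := farP c1; have [_ n2 h2 i2 k2] := farP c2.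
have [_ n3 h3 i3 k3] := farP c3; have [_ n4 h4 i4 k4] := farP c4.
have f1V := far_in hv e1S c1; have f2V := far_in hv e2S c2.
have f3V := far_in hv e3S c3; have f4V := far_in hv e4S c4.
have f12 := far_inj hr e1S e2S c1 c2 e12.
have f34 := far_inj hr e3S e4S c3 c4 e34.
pose f e := far en x e.
pose en1 := split_off en e1 (f e1) (f e2).
pose en2 := split_off en1 e3 (f e3) (f e4).
pose S1 := S :\ e2; pose S2 := S1 :\ e4.
have e3S1 : e3 \in S1 by rewrite !inE eq_sym e23.
have e4S1 : e4 \in S1 by rewrite !inE eq_sym e24.
have E3 : en1 e3 = en e3 by apply: split_off_neq; rewrite eq_sym.
have E4 : en1 e4 = en e4 by apply: split_off_neq; rewrite eq_sym.
have ends2 e : e \in S2 -> (en2 e).1 \in V :\ x /\ (en2 e).2 \in V :\ x.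
  move=> eS2; rewrite /en2 /en1 /split_off; case: eqVneq => [//|e_3].
  case: eqVneq => [//|e_1]; move: eS2; rewrite 4!inE => /and3P[e_4 e_2 eS].
  have ncr : ~~ crosses en [set x] e.
    apply/negP => cr; have : e \in [set e in S | crosses en [set x] e] by rewrite inE eS.
    by rewrite mem !inE (negbTE e_1) (negbTE e_2) (negbTE e_3) (negbTE e_4).
  have [p q] := avoid_ends hr eS ncr; have [p' q'] := valid_ends hv eS.
  by rewrite !inE p q p' q'.
apply: (orient_split e1S e2S e12 i1 i2 h1 h2).
apply: (@orient_split _ _ _ _ _ _ e3 e4 x (f e3) (f e4) _ _ e3S1 e4S1 e34 i3 i4).
- by move=> v; rewrite -h3 /inc -/(f e1) -/(f e2) -/en1 E3.
- by move=> v; rewrite -h4 /inc -/(f e1) -/(f e2) -/en1 E4.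
apply: (@orient_isolated _ _ _ _ _ _ x).
- by move=> e /ends2; rewrite /inc !inE => -[/andP[/negbTE -> _] /andP[/negbTE -> _]].
- by move: hc ht; rewrite /dist6; clear; lia.
have sumc : (\sum_(y in V) (a y + b y) = \sum_(y in V :\ x) (a y + b y))%N.
  by rewrite (big_setD1 x xV) /= hc.
have sumt : \sum_(y in V) t y = t x + \sum_(y in V :\ x) t y by exact: big_setD1.
apply: IH; last first.
  have hS := cardsD1 e2 S; rewrite e2S in hS.
  have hS1 := cardsD1 e4 S1; rewrite e4S1 in hS1.
  have hV := cardsD1 x V; rewrite xV in hV.
  rewrite /size_of sumc; move: hS hS1 hV; rewrite /S2 /S1; clear; lia.
split=> //.
- have gx : (6 %| t x + (a x)%:Z - (b x)%:Z)%Z.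
    by move: hc ht; rewrite /dist6; clear; lia.
  by have := valid_sum hv; rewrite (big_setD1 x xV) /= rpredDl.
- move=> A A0 AV; have AVx := proper_sub AV.
  have xA : x \notin A by apply/negP => /(subsetP AVx); rewrite !inE eqxx.
  have AV' : A \proper V by apply: proper_sub_trans AV (subsetDl _ _).
  have hK : (cut en2 S2 A + ((f e3 \in A) + (f e4 \in A)) =
     cut en1 S1 A + ((f e3 \in A) (+) (f e4 \in A)))%N.
    apply: (cut_split (x := x)) => //.
      by rewrite /crosses E3 [LHS]k3 (negbTE xA).
    by rewrite /crosses E4 [LHS]k4 (negbTE xA).
  have hM : (cut en1 S1 A + ((f e1 \in A) + (f e2 \in A)) =
     cut en S A + ((f e1 \in A) (+) (f e2 \in A)))%N.
    by apply: (cut_split (x := x)) => //; rewrite ?k1 ?k2 (negbTE xA).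
  have hA := valid_cut hv A0 AV'.
  have big2 e e' : f e != f e' -> f e \in A -> f e' \in A ->
    (6 + dist6 (\sum_(x in A) t x)%R <= cut en S A + \sum_(x in A) (a x + b x))%N.
    move=> ne p q; apply: (reduced_big hr _ AV').
    by apply/card_gt1P; exists (f e), (f e').
  (* With all four neighbours in [A], compare with [A] extended by [x]. *)
  have all4 : f e1 \in A -> f e2 \in A -> f e3 \in A -> f e4 \in A ->
     exists2 D, (D + 4 = cut en S A)%N &
       ample (D + \sum_(x in A) (a x + b x)) (\sum_(x in A) t x).
    move=> p1 p2 p3 p4; exists (cut en S (x |: A)).
      have e2S' : e2 \in S :\ e1 by rewrite !inE eq_sym e12.
      have e3S' : e3 \in S :\ e1 :\ e2 by rewrite !inE !(eq_sym e3) e13 e23.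
      have e4S' : e4 \in S :\ e1 :\ e2 :\ e3 by rewrite !inE !(eq_sym e4) e14 e24 e34.
      rewrite !(cut_D1 _ _ e1S) !(cut_D1 _ _ e2S') !(cut_D1 _ _ e3S') !(cut_D1 _ _ e4S').
      rewrite !k1 !k2 !k3 !k4 (negbTE xA) p1 p2 p3 p4 !inE eqxx p1 p2 p3 p4 !orbT /=.
      have -> : cut en (S :\ e1 :\ e2 :\ e3 :\ e4) (x |: A) =
                cut en (S :\ e1 :\ e2 :\ e3 :\ e4) A; last by clear; lia.
      apply: eq_bigr => e; rewrite 8!inE => /and5P[e_4 e_3 e_2 e_1 eS].
      have ncr : ~~ crosses en [set x] e.
        apply/negP => cr.
        have : e \in [set e in S | crosses en [set x] e] by rewrite inE eS.
        by rewrite mem !inE (negbTE e_1) (negbTE e_2) (negbTE e_3) (negbTE e_4).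
      have [p q] := avoid_ends hr eS ncr.
      by rewrite /crosses !inE (negbTE p) (negbTE q).
    have xA0 : x |: A != set0 by apply/set0Pn; exists x; rewrite setU11.
    have xAV : x |: A \proper V.
      case/properP: AV => _ [y]; rewrite !inE => /andP[yx yV] yA; apply/properP; split.
        by rewrite subUset sub1set xV (proper_sub AV').
      by exists y; rewrite // !inE negb_or yx.
    have := valid_cut hv xA0 xAV.
    by rewrite !big_setU1 //= hc ample_shift.
  rewrite -/S1 -/S2 -/(f e1) -/(f e2) -/en1 -/en2.
  move: hK hM hA (big2 e1 e2 f12) (big2 e3 e4 f34) all4; clear.
  rewrite /ample; case: (f e1 \in A); case: (f e2 \in A); case: (f e3 \in A);
    case: (f e4 \in A) => //= hK hM hA g1 g2 g3;
    try (have h1 := g1 isT isT); try (have h2 := g2 isT isT);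
    try (have [D h3 h4] := g3 isT isT isT isT); clear g1 g2 g3; lia.
- by have := valid_root hv; rewrite sumc sumt dist6_shift.
Qed.

(** The arc from the root to [x] continues along the edge [e1], which turns it into an
    arc from the root to the other end of [e1]; the two remaining edges are split
    off as a pair. *)
Lemma reduce_split3 en S V a b t x :
  solvable_below T E (size_of S V a b) -> reduced en S V a b t ->
  x \in V -> deg en S a b x = 4 -> dist6 (t x) = 0%N -> a x = 1%N -> b x = 0%N ->
  solvable en S V a b t.
Proof.
move=> IH hr xV hd ht ax bx; have hv := reduced_valid hr.
have : #|[set e in S | crosses en [set x] e]| = 3.
  by rewrite -cut1_card; move: hd; rewrite /deg ax bx; clear; lia.
case/set_seq => -[|e1 [|e2 [|e3 [|? ?]]]] [] // ur _ mem.
move: (ur); rewrite /= !inE !negb_or -!andbA andbT.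
case/and3P => e12 e13 e23.
have memS e : e \in [:: e1; e2; e3] -> e \in S /\ crosses en [set x] e.
  by rewrite -mem inE => /andP.
have /memS[e1S c1] : e1 \in [:: e1; e2; e3] by rewrite !inE eqxx.
have /memS[e2S c2] : e2 \in [:: e1; e2; e3] by rewrite !inE eqxx orbT.
have /memS[e3S c3] : e3 \in [:: e1; e2; e3] by rewrite !inE eqxx !orbT.
have [_ n1 h1 i1 k1] := farP c1; have [_ n2 h2 i2 k2] := farP c2.
have [_ n3 h3 i3 k3] := farP c3.
have f1V := far_in hv e1S c1; have f2V := far_in hv e2S c2.
have f3V := far_in hv e3S c3.
have f23 := far_inj hr e2S e3S c2 c3 e23.
pose f e := far en x e.
pose S1 := S :\ e1; pose S2 := S1 :\ e3.
pose en2 := split_off en e2 (f e2) (f e3).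
(* The root arc moves from [x] to the far end of [e1]. *)
pose a' y := (a y - (x == y) + (f e1 == y))%N.
have e2S1 : e2 \in S1 by rewrite !inE eq_sym e12.
have e3S1 : e3 \in S1 by rewrite !inE eq_sym e13.
have ends2 e : e \in S2 -> (en2 e).1 \in V :\ x /\ (en2 e).2 \in V :\ x.
  move=> eS2; rewrite /en2 /split_off; case: eqVneq => [//|e_2].
  move: eS2; rewrite 4!inE => /and3P[e_3 e_1 eS].
  have ncr : ~~ crosses en [set x] e.
    apply/negP => cr; have : e \in [set e in S | crosses en [set x] e] by rewrite inE eS.
    by rewrite mem !inE (negbTE e_1) (negbTE e_2) (negbTE e_3).
  have [p q] := avoid_ends hr eS ncr; have [p' q'] := valid_ends hv eS.
  by rewrite !inE p q p' q'.
have a'E y : (a' y)%:Z = (a y)%:Z - (x == y)%:Z + (f e1 == y)%:Z.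
  by rewrite /a'; case: eqP => [<-|_]; rewrite ?ax; clear; lia.
apply: (@orient_insert _ _ _ _ _ _ (fun y => t y + (a' y)%:Z - (b y)%:Z) e1 (inc en e1 x)) => //.
  move=> y _; rewrite a'E (h1 y) -/(f e1).
  by case: i1 => ->; rewrite (_ : _ - _ = 0) //; ring.
apply: (orient_split e2S1 e3S1 e23 i2 i3 h2 h3).
apply: (@orient_isolated _ _ _ _ _ _ x).
- by move=> e /ends2; rewrite /inc !inE => -[/andP[/negbTE -> _] /andP[/negbTE -> _]].
- rewrite a'E eqxx (negbTE n1) ax bx; move: ht; rewrite /dist6; clear; lia.
have hc' A : (\sum_(y in A) (a' y + b y) + (x \in A) =
              \sum_(y in A) (a y + b y) + (f e1 \in A))%N.
  rewrite -(sum_eq1 A x) -(sum_eq1 A (f e1)) -!big_split; apply: eq_bigr => y _ /=.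
  have := a'E y; clear; lia.
have sumc : (\sum_(y in V :\ x) (a' y + b y) = \sum_(y in V) (a y + b y))%N.
  have := hc' (V :\ x); rewrite f1V (big_setD1 x xV) /= ax bx !inE eqxx; clear; lia.
have sumt : \sum_(y in V) t y = t x + \sum_(y in V :\ x) t y by exact: big_setD1.
apply: IH; last first.
  have hS := cardsD1 e1 S; rewrite e1S in hS.
  have hS1 := cardsD1 e3 S1; rewrite e3S1 in hS1.
  have hV := cardsD1 x V; rewrite xV in hV.
  rewrite /size_of sumc; move: hS hS1 hV; rewrite /S2 /S1; clear; lia.
split=> //.
- have -> : \sum_(y in V :\ x) (t y + (a' y)%:Z - (b y)%:Z) =
    \sum_(y in V) (t y + (a y)%:Z - (b y)%:Z) - t x.
    rewrite [in RHS](big_setD1 x xV) /= ax bx.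
    rewrite (eq_bigr (fun y => (t y + (a y)%:Z - (b y)%:Z) + ((f e1 == y)%:Z - (x == y)%:Z))).
      rewrite big_split /= [X in _ + X]sumrB -!sum_natz !sum_eq1 f1V /= !inE eqxx /=; ring.
    by move=> y _; rewrite a'E; ring.
  have htx : (6 %| t x)%Z by move: ht; rewrite /dist6; clear; lia.
  by rewrite rpredB ?(valid_sum hv).
- move=> A A0 AV; have AVx := proper_sub AV.
  have xA : x \notin A by apply/negP => /(subsetP AVx); rewrite !inE eqxx.
  have AV' : A \proper V by apply: proper_sub_trans AV (subsetDl _ _).
  have hK : (cut en2 S2 A + ((f e2 \in A) + (f e3 \in A)) =
     cut en S1 A + ((f e2 \in A) (+) (f e3 \in A)))%N.
    by apply: (cut_split (x := x)) => //; rewrite ?k2 ?k3 (negbTE xA).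
  have hM : (cut en S A = (f e1 \in A) + cut en S1 A)%N.
    by rewrite (cut_D1 _ _ e1S) k1 (negbTE xA).
  have hA := valid_cut hv A0 AV'; have hcA := hc' A; rewrite (negbTE xA) in hcA.
  have big2 : f e2 \in A -> f e3 \in A ->
    (6 + dist6 (\sum_(x in A) t x)%R <= cut en S A + \sum_(x in A) (a x + b x))%N.
    move=> p q; apply: (reduced_big hr _ AV').
    by apply/card_gt1P; exists (f e2), (f e3).
  rewrite -/S1 -/S2 -/(f e2) -/(f e3) -/en2.
  move: hK hM hA hcA big2; clear.
  rewrite /ample; case: (f e1 \in A); case: (f e2 \in A); case: (f e3 \in A) => //=
     hK hM hA hcA g1; try (have h1 := g1 isT isT); clear g1; lia.
- by have := valid_root hv; rewrite sumc sumt dist6_shift.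
Qed.

Lemma reduce_split en S V a b t x :
  solvable_below T E (size_of S V a b) -> reduced en S V a b t ->
  x \in V -> deg en S a b x = 4 -> dist6 (t x) = 0%N -> solvable en S V a b t.
Proof.
move=> IH hr xV hd ht; have hc := split_root_deg hr xV hd ht.
case: (posnP (a x)) => ax; case: (posnP (b x)) => bx.
- by apply: reduce_split4 hd ht _ => //; rewrite ax bx.
- apply: solvable_opp; apply: (@reduce_split3 _ _ _ _ _ _ x) => //.
  + by rewrite size_opp.
  + exact: reduced_opp.
  + by move: hd; rewrite /deg addnC [(b x + a x)%N]addnC addnC.
  + by rewrite dist6N.
  + by move: hc bx; rewrite ax; clear; lia.
- by apply: reduce_split3 hd ht _ _ => //; move: hc ax; rewrite bx; clear; lia.
- by move: hc ax bx; clear; lia.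
Qed.

End Splitting.

(** * Extending a pre-orientation at the root *)

(** The shape to which all vertices are reduced: no boundary edge to spare and a
    residue 1 or 2, so that only outgoing edges can be deleted. *)
Definition low (d : nat) (t : int) : bool :=
  (d == 4 + dist6 t)%N && ((t %% 6 == 1)%Z || (t %% 6 == 2)%Z).

Section Final.
Variables T E : finType.
Implicit Types (en : E -> T * T) (S : {set E}) (V A B : {set T}) (e : E).
Implicit Types (a b : T -> nat) (t g : T -> int) (s : E -> int).

(** A set and its complement without edges between them would need at least four arcs
    each at the root, which has at most seven. *)
Lemma cut_gt0 en S V a b t A : valid en S V a b t ->
  A != set0 -> A \proper V -> (0 < cut en S A)%N.
Proof.
move=> hv A0 AV; rewrite lt0n; apply/eqP => cut0.
have /properP[AsV [y yV yA]] := AV.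
have B0 : V :\: A != set0 by apply/set0Pn; exists y; rewrite inE yA.
have BV : V :\: A \proper V.
  case/set0Pn: A0 => x xA; apply/properP; split; first exact: subsetDl.
  by exists x; [exact: subsetP AsV _ xA | rewrite inE xA].
have := valid_cut hv A0 AV; have := valid_cut hv B0 BV.
have := root_le7 hv; rewrite (big_setID A) /= (setIidPr AsV).
rewrite (cutC A (valid_ends hv)) cut0 /ample; clear; lia.
Qed.

(** With no arc at the root, the root is dropped and [x] takes its place: its degree
    4 + t is just small enough. Choosing two of its edges as incoming gives the
    net outdegree t. *)
Lemma reduce_root en S V a b t x :
  solvable_below T E (size_of S V a b) -> reduced en S V a b t ->
  x \in V -> (\sum_(y in V) (a y + b y) = 0)%N -> low (deg en S a b x) (t x) ->
  solvable en S V a b t.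
Proof.
move=> IH hr xV hc /andP[/eqP hd hlow]; have hv := reduced_valid hr.
have c0 y : y \in V -> (a y + b y = 0)%N.
  by move=> yV; apply/eqP; move/eqP: hc; rewrite sum_nat_eq0 => /forall_inP /(_ y yV).
have hdeg : cut en S [set x] = deg en S a b x by rewrite /deg c0 // addn0.
have : (1 < #|[set e in S | crosses en [set x] e]|)%N.
  by rewrite -cut1_card hdeg hd.
case/card_gt1P => e1 [e2 []]; rewrite !inE => /andP[e1S ce1] /andP[e2S ce2] e12.
have e2S1 : e2 \in S :\ e1 by rewrite !inE eq_sym e12.
pose s1 e := if crosses en [set x] e then
  inc en e x * (if (e == e1) || (e == e2) then -1 else 1) else 1.
have hs1 : signs s1.
  move=> e; rewrite /s1; case: ifP => [cr|_]; last by left.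
  by have [_ _ _ [->|->] _] := farP cr; case: ifP => _; rewrite ?mulr1 ?mul1r; auto.
have term e : s1 e * inc en e x =
    if crosses en [set x] e then (if (e == e1) || (e == e2) then -1 else 1) else 0.
  rewrite /s1; case: ifP => [cr|ncr].
    by have [_ _ _ [->|->] _] := farP cr; case: ifP.
  by move: ncr; rewrite /crosses /inc !inE; case: eqP; case: eqP.
have net1 : net en S s1 x = (t x %% 6)%Z.
  rewrite (net_D1 _ _ _ e1S) (net_D1 _ _ _ e2S1) !term ce1 ce2 !eqxx orbT /=.
  have -> : net en (S :\ e1 :\ e2) s1 x = (cut en (S :\ e1 :\ e2) [set x])%:Z.
    rewrite /net /cut sum_natz; apply: eq_bigr => e; rewrite term 4!inE.
    by case/and3P=> /negbTE -> /negbTE -> _; case: (crosses _ _ _).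
  move: hdeg; rewrite hd (cut_D1 _ _ e1S) (cut_D1 _ _ e2S1) ce1 ce2.
  move: hlow; rewrite /dist6; clear; lia.
pose A := V :\ x.
have AV : A \proper V by rewrite properD1.
have hcA : (\sum_(y in A) (a y + b y) = 0)%N.
  by apply: big1 => y /setD1P[_]; apply: c0.
have g0 y : y \in V -> t y + (a y)%:Z - (b y)%:Z = t y.
  by move/c0; clear; lia.
have sumV : (6 %| \sum_(y in V) t y)%Z.
  by have := valid_sum hv; rewrite (eq_bigr _ g0).
have sumA : \sum_(y in V) t y = t x + \sum_(y in A) t y by exact: big_setD1.
have netA : \sum_(y in A) net en S s1 y = - net en S s1 x.
  have : \sum_(y in V) net en S s1 y = 0.
    rewrite sum_net big1 // => e /(valid_ends hv)[-> ->].
    by rewrite subrr mulr0.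
  by rewrite (big_setD1 x xV) /= addrC => /eqP; rewrite addr_eq0 => /eqP.
have [||s [hs hagree hA]] := restrict IH hv hs1 AV.
- rewrite hcA addn0 (cutC _ (valid_ends hv)) hdeg hd.
  by move: hlow sumV; rewrite sumA /dist6; clear; lia.
- rewrite sumrB netA net1 (eq_bigr t).
    move: sumV; rewrite sumA opprK; move: (t x) (\sum_(y in A) t y) => p q; clear; lia.
  by move=> y /setD1P[_]; apply: g0.
exists s => // y yV; have [->|yx] := eqVneq y x; last by apply: hA; rewrite !inE yx.
rewrite g0 // (_ : net en S s x = net en S s1 x).
  by rewrite net1; clear; lia.
apply: eq_net => e eS.
have [/andP[p q]|/hagree ->//] := boolP (((en e).1 \in A) && ((en e).2 \in A)).
by move: p q; rewrite /inc !inE => /andP[/negbTE -> _] /andP[/negbTE -> _]; rewrite !mulr0.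
Qed.

(** One arc from the root to [x] contributes -1 at [x], and two arcs in the opposite
    direction contribute 2. The exchange adds one boundary edge to each set
    containing [x] and shifts its residue by 3; deleting an edge oriented towards
    [x] then shifts [t x] by one more, to -1 or 0, without asking for more edges
    at [x]. The number of arcs at the root grows, but [size_of] drops since an
    edge is lost. *)
Lemma reduce_double en S V a b t x :
  solvable_below T E (size_of S V a b) -> reduced en S V a b t ->
  (forall y, y \in V -> low (deg en S a b y) (t y)) ->
  (forall y, y \in V -> b y = 0%N) -> x \in V -> (0 < a x)%N ->
  solvable en S V a b t.
Proof.
move=> IH hr hlow b0 xV ax; have hv := reduced_valid hr.
have := cut_gt0 hv _ (set1_proper (reduced_V hr) xV).
rewrite cut1_card => /(_ _) -/(_ _)/card_gt0P[|e].
  by apply/set0Pn; exists x; rewrite inE.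
rewrite inE => /andP[eS cr].
have [_ nf hinc hi hcr] := farP cr; have := far_in hv eS cr.
move: (far en x e) nf hinc hcr => f nf hinc hcr; rewrite in_setD1 nf /= => fV.
(* At [x]: -3 for the exchange of arcs and +1 for the deleted incoming edge. *)
pose t' y := (t y - 2 * (x == y)%:Z) - 1 * (f == y)%:Z.
pose a' y := (a y - (x == y))%N; pose b' y := (b y + 2 * (x == y))%N.
have a'E y : (a' y)%:Z = (a y)%:Z - (x == y)%:Z.
  by rewrite /a'; case: eqP => [<-|_]; clear -ax; lia.
have sumt A : \sum_(y in A) t' y =
    \sum_(y in A) t y - 2 * (x \in A)%:Z - 1 * (f \in A)%:Z.
  by rewrite !sumz_shift.
have sumc A : (\sum_(y in A) (a' y + b' y) = \sum_(y in A) (a y + b y) + (x \in A))%N.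
  rewrite -(sum_eq1 A x) -big_split; apply: eq_bigr => y _ /=.
  by have := a'E y; rewrite /b'; clear; lia.
apply: (@orient_insert _ _ _ _ _ _ (fun y => t' y + (a' y)%:Z - (b' y)%:Z) e (- inc en e x)) => //.
- by case: hi => ->; [right|left].
- move=> y _; rewrite (hinc y) a'E /t' /b'.
  by case: hi => ->; case: (x == y); case: (f == y); clear; lia.
have hcV := sumc V; rewrite xV in hcV.
apply: IH; last by rewrite /size_of hcV (cardsD1 e S) eS; clear; lia.
split.
- by move=> e' /setD1P[_ /(valid_ends hv)].
- rewrite (eq_bigr (fun y => (t y + (a y)%:Z - (b y)%:Z) - 5 * (x == y)%:Z - 1 * (f == y)%:Z)).
    by rewrite !sumz_shift xV fV -addrA rpredD ?(valid_sum hv).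
  by move=> y _; rewrite a'E /t' /b'; clear; lia.
- move=> A A0 AV; rewrite sumt sumc.
  have := valid_cut hv A0 AV; rewrite (cut_D1 _ _ eS) hcr.
  have [[y Ay]|A1] := setP1 A0.
    have yV : y \in V by apply: (subsetP (proper_sub AV)); rewrite Ay inE.
    have := hlow y yV; rewrite /deg (cut_D1 _ _ eS) hcr Ay !big_set1 !inE.
    have [<-|xy] := eqVneq x y.
      by rewrite (negbTE nf) /ample /low /dist6; clear; lia.
    by case: (f == y); rewrite /ample /low /dist6; clear; lia.
  have := reduced_big hr A1 AV; rewrite (cut_D1 _ _ eS) hcr.
  by case: (x \in A); case: (f \in A); rewrite /ample /dist6; clear; lia.
- rewrite sumt hcV xV fV.
  have hb : (\sum_(y in V) b y = 0)%N by apply: big1.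
  have hpos : (0 < \sum_(y in V) a y)%N by rewrite (big_setD1 x xV) /=; clear -ax; lia.
  have := valid_root hv; have := valid_sum hv.
  rewrite sumrB !big_split /= -!sum_natz hb.
  move: hpos; move: (\sum_(y in V) a y)%N (\sum_(y in V) t y) => p q.
  by rewrite /dist6; clear; lia.
Qed.

Lemma solve_low en S V a b t :
  solvable_below T E (size_of S V a b) -> reduced en S V a b t ->
  (forall y, y \in V -> low (deg en S a b y) (t y)) -> solvable en S V a b t.
Proof.
move=> IH hr hlow.
have [/exists_inP[x xV bx]|nb] := boolP [exists x in V, (0 < b x)%N].
  apply: (reduce_in_arc IH hr xV bx).
  by have := hlow x xV; rewrite /low /dist6; clear; lia.
have b0 y : y \in V -> b y = 0%N.
  move=> yV; apply/eqP; rewrite -leqn0 leqNgt.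
  by apply: contra nb => h; apply/exists_inP; exists y.
have [/exists_inP[x xV ax]|na] := boolP [exists x in V, (0 < a x)%N].
  exact: reduce_double xV ax.
have /card_gt1P[x [_ [xV _ _]]] := reduced_V hr.
apply: (reduce_root IH hr xV _ (hlow x xV)).
apply: big1 => y yV; rewrite b0 // addn0; apply/eqP; rewrite -leqn0 leqNgt.
by apply: contra na => h; apply/exists_inP; exists y.
Qed.

(** A set crossed by no edge is empty or full, by [cut_gt0]. *)
Lemma monochromatic en S V a b t (P : pred T) : valid en S V a b t ->
  (forall e, e \in S -> P (en e).1 = P (en e).2) ->
  {in V, forall x, P x} \/ {in V, forall x, ~~ P x}.
Proof.
move=> hv hP; pose A := [set x in V | P x].
have cut0 : cut en S A = 0%N.
  apply: big1 => e eS; have [p q] := valid_ends hv eS.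
  by rewrite /crosses !inE p q /= hP // addbb.
have [A0|A0] := eqVneq A set0.
  right=> x xV; apply/negP => Px; have : x \in A by rewrite inE xV.
  by rewrite A0 inE.
left=> x xV; have [AV|] := boolP (A \proper V).
  by have := cut_gt0 hv A0 AV; rewrite cut0.
rewrite properE negb_and negbK => /orP[/negP[]|VA].
  by apply/subsetP => y; rewrite inE => /andP[].
by have := subsetP VA x xV; rewrite inE => /andP[].
Qed.

(** Call a vertex [pos] if it survives the deletion of an outgoing edge and [neg] if
    it survives that of an incoming one. Once balanced vertices of degree four
    are gone every vertex is [pos] or [neg], and an edge from a [pos] to a [neg]
    vertex could be deleted. So the type is constant along edges. *)
Lemma solve_reduced en S V a b t :
  solvable_below T E (size_of S V a b) -> reduced en S V a b t ->
  solvable en S V a b t.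
Proof.
move=> IH hr; have hv := reduced_valid hr.
have [/exists_inP[x xV /andP[/eqP hd /eqP ht]]|nsplit] :=
  boolP [exists x in V, (deg en S a b x == 4) && (dist6 (t x) == 0%N)].
  exact: reduce_split IH hr xV hd ht.
pose pos x := (5 + dist6 (t x - 1)%R <= deg en S a b x)%N.
pose neg x := (5 + dist6 (t x + 1)%R <= deg en S a b x)%N.
have posneg x : x \in V -> pos x || neg x.
  move=> xV; have := ample_deg hr xV.
  have : ~~ ((deg en S a b x == 4) && (dist6 (t x) == 0%N)).
    by apply: contra nsplit => h; apply/exists_inP; exists x.
  by rewrite /pos /neg /ample /dist6; clear; lia.
have [/exists_inP[e eS /andP[pu nv]]|nedge] :=
  boolP [exists e in S, pos (en e).1 && neg (en e).2].
  apply: (reduce_edge (eps := 1) IH hr eS); first by left.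
  have := reduced_loop hr eS; rewrite /inc => ne x /orP[] /eqP ->.
    by rewrite eqxx (eq_sym _ (en e).1) (negbTE ne) mul1r.
  by rewrite eqxx (negbTE ne) mul1r sub0r opprK.
have [/exists_inP[e eS /andP[nu pv]]|nedge'] :=
  boolP [exists e in S, neg (en e).1 && pos (en e).2].
  apply: (reduce_edge (eps := -1) IH hr eS); first by right.
  have := reduced_loop hr eS; rewrite /inc => ne x /orP[] /eqP ->.
    by rewrite eqxx (eq_sym _ (en e).1) (negbTE ne) subr0 mulr1 opprK.
  by rewrite eqxx (negbTE ne) sub0r mulrNN mulr1.
have nopn e : e \in S -> ~~ (pos (en e).1 && neg (en e).2).
  by move=> eS; apply: contra nedge => h; apply/exists_inP; exists e.
have nonp e : e \in S -> ~~ (neg (en e).1 && pos (en e).2).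
  by move=> eS; apply: contra nedge' => h; apply/exists_inP; exists e.
have edge_type e : e \in S ->
    pos (en e).1 = pos (en e).2 /\ pos (en e).1 = ~~ neg (en e).1.
  move=> eS; have [uV vV] := valid_ends hv eS.
  have := posneg _ uV; have := posneg _ vV; have := nopn e eS; have := nonp e eS.
  by case: (pos _); case: (neg _); case: (pos _); case: (neg _).
have pos_xor x : x \in V -> pos x = ~~ neg x.
  move=> xV; have x0 : [set x] != set0 by apply/set0Pn; exists x; rewrite inE.
  have := cut_gt0 hv x0 (set1_proper (reduced_V hr) xV).
  rewrite cut1_card => /card_gt0P[e]; rewrite inE => /andP[eS cr].
  have [+ _ _ _ _] := farP cr; have [h1 h2] := edge_type e eS.
  have [uV vV] := valid_ends hv eS.
  have := posneg _ vV; have := nopn e eS; have := nonp e eS.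
  move=> p q r [] he; move: h1 h2 p q r; rewrite he /=;
    by case: (pos _); case: (neg _); case: (pos _); case: (neg _).
have [hpos|hneg] := monochromatic hv (fun e eS => (edge_type e eS).1).
  apply: solve_low => // y yV; have := ample_deg hr yV.
  have := hpos y yV; have := pos_xor y yV; rewrite /pos /neg /ample /low /dist6.
  clear; lia.
apply: solvable_opp; apply: solve_low; first by rewrite size_opp.
  exact: reduced_opp.
move=> y yV; have := ample_deg hr yV.
have -> : deg en S b a y = deg en S a b y by rewrite /deg (addnC (b y)).
have := hneg y yV; have := posneg y yV; rewrite /pos /neg /ample /low /dist6.
clear; lia.
Qed.

(** The extension theorem of Lovász, Thomassen, Wu and Zhang for modulus 3. *)
Theorem mod3_orientation en S V a b t :
  valid en S V a b t -> solvable en S V a b t.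
Proof.
suff H n : solvable_below T E n by move=> hv; apply: (H _ _ _ _ _ _ _ hv (ltnSn _)).
elim: n => [//|n IHn] {}en {}S {}V {}a {}b {}t hv; rewrite ltnS => hn.
have IH : solvable_below T E (size_of S V a b).
  by move=> en' S' V' a' b' t' hv' h; apply: IHn hv' (leq_trans h hn).
have [|V1] := leqP #|V| 1; first by move=> h; apply: orient_small.
have [/exists_inP[e eS /eqP loop]|nloop] :=
  boolP [exists e in S, (en e).1 == (en e).2]; first exact: reduce_loop loop.
have loopless e : e \in S -> (en e).1 != (en e).2.
  by move=> eS; apply: contra nloop => h; apply/exists_inP; exists e.
have [/exists_inP[e1 e1S /exists_inP[e2 e2S /andP[e12 par]]]|npar] :=
  boolP [exists e1 in S, exists e2 in S, (e1 != e2) &&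
    ((en e2 == en e1) || (en e2 == ((en e1).2, (en e1).1)))].
  exact: reduce_parallel (loopless _ e1S) par.
have [/existsP[A /and3P[A1 AV hA]]|ntight] :=
  boolP [exists A : {set T}, [&& (1 < #|A|)%N, A \proper V &
    (cut en S A + \sum_(x in A) (a x + b x) <= 5 + dist6 (\sum_(x in A) t x)%R)%N]].
  exact: reduce_tight A1 AV hA.
apply: solve_reduced => //; split=> // [e1 e2 e1S e2S e12|A A1 AV].
  apply: contra npar => h; apply/exists_inP; exists e1 => //.
  by apply/exists_inP; exists e2; rewrite // e12.
rewrite leqNgt; apply: contra ntight => h; apply/existsP; exists A.
by rewrite A1 AV.
Qed.

End Final.

(** * From residues modulo 3 to integers, and edge cuts of graphs *)

Section IntegerFlow.
Variables T E : finType.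
Variable en : E -> T * T.
Hypothesis loopless : forall e, (en e).1 != (en e).2.
Implicit Types (f : E -> int) (x y v : T) (e : E).

Definition nz3 f : Prop := forall e, f e \in [:: 1; -1; 2; -2].

Definition excess f x : int := net en setT f x.

(** A step goes along an edge that carries positive flow out of the first vertex. *)
Definition residual f : rel T :=
  fun x y => [exists e, (0 < f e * inc en e x) && (far en x e == y)].

Lemma inc_crosses e x : inc en e x != 0 -> crosses en [set x] e.
Proof. by rewrite /inc /crosses !inE; case: (_ == x); case: (_ == x). Qed.

(** A value 1 or 2 becomes -2 or -1, so no edge gets the value 0. *)
Lemma push_arc f x y : nz3 f -> residual f x y ->
  exists e f1, [/\ nz3 f1, en e = (x, y) \/ en e = (y, x),
    forall e', e' != e -> f1 e' = f e' &
    forall v, excess f1 v = excess f v - 3 * (x == v)%:Z + 3 * (y == v)%:Z].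
Proof.
move=> nzf /existsP[e /andP[pos /eqP fy]]; have ix : inc en e x != 0.
  by apply: contraTneq pos => ->; rewrite mulr0 ltxx.
have [hen _ hinc hi _] := farP (inc_crosses ix); rewrite fy in hen hinc.
exists e, (fun e' => f e' - (if e' == e then 3 * inc en e x else 0)); split=> //.
- move=> e'; case: eqP => [->|_]; last by rewrite subr0.
  have := nzf e; case: hi pos => ->; rewrite !inE; clear; lia.
- by move=> e' /negbTE ->; rewrite subr0.
move=> v; rewrite /excess !(net_D1 _ _ _ (in_setT e)) eqxx.
rewrite (eq_net (en' := en) (s' := f)) => [|e']; last first.
  by rewrite !inE andbT => /negbTE ->; rewrite subr0.
move: (net _ _ _ _) => r; rewrite (hinc v).
by case: hi => ->; clear; ring.
Qed.

(** Along a path without repeated vertices the first push only changes an edge at [x],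
    so the later steps remain residual. *)
Lemma push_path f x p : nz3 f -> path (residual f) x p -> uniq (x :: p) ->
  exists2 f', nz3 f' & forall v,
    excess f' v = excess f v - 3 * (x == v)%:Z + 3 * (last x p == v)%:Z.
Proof.
elim: p x f => [|y p IHp] x f nzf.
  by move=> _ _; exists f => // v /=; ring.
move=> /= /andP[xy path_p] /andP[xp up].
have [e [f1 [nz1 hen same ex1]]] := push_arc nzf xy.
have [|//|f' nz' ex'] := IHp y f1 nz1.
  have sub : {in [pred z | z != x] &, subrel (residual f) (residual f1)}.
    move=> u w; rewrite !inE => ux wx /existsP[e' /andP[pos /eqP fw]].
    apply/existsP; exists e'; rewrite fw eqxx andbT same //.
    have iu : inc en e' u != 0.
      by apply: contraTneq pos => ->; rewrite mulr0 ltxx.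
    have [hen' _ _ _ _] := farP (inc_crosses iu); rewrite fw in hen'.
    apply/eqP => ee; rewrite ee in hen'.
    case: hen hen' => -> [] [h1 h2]; move: ux wx;
      by rewrite ?h1 ?eqxx // h2 eqxx ?andbF.
  apply: (sub_in_path sub) path_p; apply/allP => z zp; rewrite inE.
  by apply: contraNneq xp => <-.
by exists f' => // v; rewrite ex' ex1; ring.
Qed.

Lemma excess_sum f : \sum_x excess f x = 0.
Proof.
transitivity (\sum_(x in setT) net en setT f x).
  by apply: eq_bigl => x; rewrite inE.
by rewrite sum_net; apply: big1 => e _; rewrite !inE subrr mulr0.
Qed.

(** Otherwise the set of reachable vertices would have positive total excess, yet no
    positive flow leaves it. *)
Lemma deficit_reachable f x : 0 < excess f x ->
  exists2 y, connect (residual f) x y & excess f y < 0.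
Proof.
move=> posx; pose R := [set y | connect (residual f) x y].
suff /existsP[y /andP[Ry hy]] : [exists y, connect (residual f) x y && (excess f y < 0)].
  by exists y.
apply: contraLR (posx) => noneg; rewrite -leNgt.
have xR : x \in R by rewrite inE connect0.
apply: (@le_trans _ _ (\sum_(y in R) excess f y)).
  rewrite (big_setD1 x xR) /= lerDl sumr_ge0 // => y; rewrite !inE => /andP[_ Ry].
  by rewrite leNgt; apply: contra noneg => h; apply/existsP; exists y; rewrite Ry.
have closed u w e : u \in R -> w \notin R -> far en u e = w -> f e * inc en e u <= 0.
  rewrite !inE => uR wR fw; rewrite leNgt; apply: contra wR => pos.
  apply: connect_trans uR (connect1 _); apply/existsP; exists e.
  by rewrite pos fw eqxx.
rewrite sum_net; apply: sumr_le0 => e _.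
have ne := loopless e.
have [uR|uR] := boolP ((en e).1 \in R); have [wR|wR] := boolP ((en e).2 \in R).
- by rewrite subrr mulr0.
- have := closed _ _ e uR wR; rewrite /far eqxx => /(_ erefl).
  by rewrite /inc eqxx (eq_sym _ (en e).1) (negbTE ne).
- have := closed _ _ e wR uR; rewrite /far (negbTE ne) => /(_ erefl).
  by rewrite /inc eqxx (negbTE ne).
- by rewrite subrr mulr0.
Qed.

Lemma integer_flow f : nz3 f -> (forall x, (3 %| excess f x)%Z) ->
  exists2 f', nz3 f' & forall x, excess f' x = 0.
Proof.
have [n] := ubnP (\sum_x `|excess f x|)%N; elim: n f => // n IHn f.
rewrite ltnS => hn nzf h3.
have [/existsP[x px]|npos] := boolP [exists x, 0 < excess f x]; last first.
  exists f => // x; have nonpos y : excess f y <= 0.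
    by rewrite leNgt; apply: contra npos => h; apply/existsP; exists y.
  have := excess_sum f; rewrite (bigD1 x) //= => hs.
  have : \sum_(i | i != x) excess f i <= 0 by apply: sumr_le0.
  have := nonpos x; move: hs; move: (\sum_(i | _) _) => r; clear; lia.
have [y /connectP[p0 path0 ->] ny] := deficit_reachable px.
case/shortenP: path0 ny => p path_p up _ {p0} ny; set y' := last x p in ny.
have [f1 nz1 ex1] := push_path nzf path_p up.
have xy : x != y' by apply: contraTneq px => ->; move: ny; clear; lia.
have h3' v : (3 %| excess f1 v)%Z.
  by rewrite ex1; have := h3 v; case: (x == v); case: (last x p == v); clear; lia.
apply: (IHn f1) => //; apply: leq_trans hn.
(* Excesses are multiples of 3, so the push brings both ends closer to 0. *)
rewrite (bigD1 x) // [X in (_ < X)%N](bigD1 x) //=.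
rewrite -addSn leq_add //.
  rewrite ex1 eqxx -/y' eq_sym (negbTE xy); have := h3 x; move: px; clear; lia.
apply: leq_sum => v vx; rewrite ex1 eq_sym (negbTE vx) -/y'.
case: eqP => [<-|_]; last by clear; lia.
have := h3 y'; move: ny; clear; lia.
Qed.

End IntegerFlow.

Section Graphs.
Variable G : mgraph.
Local Notation T := (vertex G).
Local Notation E := (edge G).
Implicit Types (X A B : {set T}) (x y r : T) (e : E).

Lemma orientation_exists : inhabited (orientation G).
Proof.
have ex e : exists p : T * T, ends e == [set p.1; p.2].
  have /eqP/cards2P[x [y [_ ->]]] := card_ends e.
  by exists (x, y).
constructor; apply: (@Orientation G (fun e => (xchoose (ex e)).1)
  (fun e => (xchoose (ex e)).2)) => e.
exact/eqP/(xchooseP (ex e)).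
Qed.

Variable D : orientation G.

Definition arc e : T * T := (tail D e, head D e).

Lemma arc_loopless e : (arc e).1 != (arc e).2.
Proof.
have := card_ends e; rewrite (ends_orientation D) cards2 /arc /=.
by case: (_ == _).
Qed.

Lemma in_boundary X e : (e \in boundary X) = crosses arc X e.
Proof.
rewrite inE (ends_orientation D) /crosses /=.
apply/exists_inP/idP => [[x xX /exists_inP[y]]|].
  rewrite inE => yX /eqP/setP eqs.
  have ne := arc_loopless e; rewrite /arc /= in ne.
  have := eqs (tail D e); have := eqs (head D e).
  rewrite !inE !eqxx orbT /= => /esym/orP[] /eqP h /esym/orP[] /eqP h'.
  - by move: ne; rewrite h h' eqxx.
  - by rewrite h h' xX (negbTE yX).
  - by rewrite h h' xX (negbTE yX).
  - by move: ne; rewrite h h' eqxx.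
have [uX|uX] := boolP (tail D e \in X) => /= vX.
  by exists (tail D e) => //; apply/exists_inP; exists (head D e); rewrite ?inE.
exists (head D e) => //; apply/exists_inP; exists (tail D e); rewrite ?inE //.
by rewrite setUC.
Qed.

Lemma cut_boundary X : cut arc setT X = #|boundary X|.
Proof.
rewrite -sum1_card /cut [LHS]big_mkcond [RHS]big_mkcond /=; apply: eq_bigr => e _.
by rewrite in_boundary inE; case: (crosses _ _ _).
Qed.

Lemma crossing_edge S X : connected (del_edges S) -> X != set0 -> X != setT ->
  exists2 e, e \notin S & e \in boundary X.
Proof.
move=> conn /set0Pn[x xX]; rewrite -subTset => /subsetPn[y _ yX].
have /connectP[p] := conn x y; elim: p x xX => [|z p IHp] x xX /=.
  by move=> _ eyx; case/negP: yX; rewrite eyx.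
case/andP => /existsP[e eqe] path_p lastp.
have [zX|zX] := boolP (z \in X); first exact: IHp path_p lastp.
exists (val e); first exact: valP e.
rewrite inE; apply/exists_inP; exists x => //.
by apply/exists_inP; exists z; rewrite ?inE.
Qed.

Lemma boundary_ge k X : edge_connected k G -> X != set0 -> X != setT ->
  (k <= #|boundary X|)%N.
Proof.
move=> conn X0 XT; rewrite leqNgt; apply/negP => /conn h.
by have [e /negP] := crossing_edge h X0 XT.
Qed.

(** Two sets with the same boundary have a symmetric difference with empty boundary,
    which misses [r], so it is empty by connectivity. *)
Lemma boundary_inj k r A B : edge_connected k.+1 G ->
  r \notin A -> r \notin B -> boundary A = boundary B -> A = B.
Proof.
move=> conn rA rB eqb; pose X := [set x | (x \in A) (+) (x \in B)].
have XT : X != setT.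
  by apply/eqP => /setP/(_ r); rewrite !inE (negbTE rA) (negbTE rB).
have [/setP X0|X0] := eqVneq X set0.
  by apply/setP => x; have := X0 x; rewrite !inE; case: (x \in A); case: (x \in B).
have := boundary_ge conn X0 XT; rewrite (_ : boundary X = set0) ?cards0 //.
apply/setP => e; rewrite in_boundary [RHS]inE /crosses !inE.
have := in_boundary A e; rewrite eqb in_boundary /crosses.
by do 4 case: (_ \in _).
Qed.

End Graphs.

(** * Attaching the root to the 5-edge-cuts *)

Section Marks.
Variables (G : mgraph) (D : orientation G).
Local Notation T := (vertex G).
Implicit Types (A B : {set T}) (x r : T).

Lemma boundaryC A : boundary (~: A) = boundary A.
Proof.
apply/setP => e; rewrite !(in_boundary D) /crosses !inE.
by case: (_ \in _); case: (_ \in _).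
Qed.

Lemma boundary_neq0 k A : #|boundary A| = k.+1 -> A != set0.
Proof.
apply: contra_eq_neq => ->; rewrite (_ : boundary set0 = set0) ?cards0 //.
by apply/setP => e; rewrite (in_boundary D) /crosses !inE.
Qed.

(** Each 5-edge-cut has exactly one side that avoids [r]. *)
Definition sides r : {set {set T}} := [set B : {set T} | (r \notin B) && (#|boundary B| == 5)].

Lemma card_sides r : edge_connected 4 G -> (#|sides r| <= #|edge_cuts G 5|)%N.
Proof.
move=> conn; rewrite -(card_in_imset (f := @boundary G)); last first.
  move=> A B; rewrite !inE => /andP[rA _] /andP[rB _].
  exact: (@boundary_inj G D 3 r A B conn rA rB).
apply/subset_leq_card/subsetP => C /imsetP[B]; rewrite !inE => /andP[_ hB] ->.
by rewrite hB andbT; apply/existsP; exists B.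
Qed.

Lemma hitting_marks r : edge_connected 4 G -> (#|edge_cuts G 5| <= 7)%N ->
  exists2 s : seq T, (size s <= 7)%N &
    forall A, #|boundary A| = 5 -> has (mem A) s.
Proof.
move=> conn le7; have F7 := leq_trans (card_sides r conn) le7.
pose repr B := odflt r [pick x in B].
have reprP B : B \in sides r -> repr B \in B.
  rewrite inE => /andP[_ /eqP /boundary_neq0/set0Pn[x xB]].
  by rewrite /repr; case: pickP => [//|/(_ x)]; rewrite xB.
have sideP A : #|boundary A| = 5 -> r \notin A -> A \in sides r.
  by move=> hA rA; rewrite inE rA hA.
have has_repr (F : {set {set T}}) A B : B \in F -> repr B \in A ->
    has (mem A) [seq repr B | B <- enum F].
  by move=> BF hB; apply/hasP; exists (repr B); rewrite ?map_f ?mem_enum.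
have [F6|F6] := leqP #|sides r| 6.
  exists (r :: [seq repr B | B <- enum (sides r)]).
    by rewrite /= size_map -cardE.
  move=> A hA /=; have [//|rA /=] := boolP (r \in A).
  by apply: (has_repr _ A A); [|apply: reprP]; apply: sideP.
have [|ndisj] := boolP [exists B1 in sides r, exists B2 in sides r,
    (B1 != B2) && (B1 :&: B2 != set0)].
  case/exists_inP => B1 B1F /exists_inP[B2 B2F /andP[B12 /set0Pn[z]]].
  rewrite inE => /andP[z1 z2].
  exists [:: r, z & [seq repr B | B <- enum (sides r :\ B1 :\ B2)]].
    rewrite /= size_map -cardE; have := cardsD1 B1 (sides r); rewrite B1F.
    have := cardsD1 B2 (sides r :\ B1); rewrite in_setD1 (eq_sym B2) B12 B2F.
    by move=> h2 h1; move: F7; rewrite h1 h2.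
  move=> A hA /=; have [//|rA /=] := boolP (r \in A).
  have AF := sideP A hA rA.
  have [->|A1] := eqVneq A B1; first by rewrite z1.
  have [->|A2] := eqVneq A B2; first by rewrite z2.
  by rewrite (has_repr _ A A) ?orbT ?reprP // !in_setD1 A1 A2.
exists [seq repr B | B <- enum (sides r)]; first by rewrite size_map -cardE.
move=> A hA; have [rA|rA] := boolP (r \in A); last first.
  by apply: (has_repr _ A A); [|apply: reprP]; apply: sideP.
have CF : ~: A \in sides r by apply: sideP; rewrite ?boundaryC // inE rA.
(* Any side other than the complement of [A] is disjoint from it, so lies in [A]. *)
have [B BF BA] : exists2 B, B \in sides r & B != ~: A.
  have : (0 < #|sides r :\ ~: A|)%N.
    by move: F6; rewrite (cardsD1 (~: A)) CF add1n ltnS; apply: leq_trans.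
  by case/card_gt0P => B /setD1P[BA BF]; exists B.
apply: (has_repr _ A B) => //; apply: contraNT ndisj => nA.
apply/exists_inP; exists B => //; apply/exists_inP; exists (~: A) => //.
rewrite BA; apply/set0Pn; exists (repr B); rewrite !inE nA andbT; exact: reprP.
Qed.

End Marks.

Lemma sum_count (I : finType) (A : {set I}) (s : seq I) :
  (\sum_(x in A) count_mem x s = count (mem A) s)%N.
Proof.
elim: s => [|y s IHs] /=; first by rewrite big1.
by rewrite big_split /= sum_eq1 IHs.
Qed.

Section Weights.
Variables T E : finType.
Variable en : E -> T * T.
Hypothesis loopless : forall e, (en e).1 != (en e).2.

(** An edge inside [A] is counted twice on the left. *)
Lemma handshake (A : {set T}) :
  (2 %| (\sum_(x in A) cut en setT [set x])%N%:Z - (cut en setT A)%:Z)%Z.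
Proof.
rewrite /cut exchange_big !sum_natz -sumrB; apply: dvdz_sum => e _.
have -> : (\sum_(x in A) crosses en [set x] e = ((en e).1 \in A) + ((en e).2 \in A))%N.
  rewrite -!sum_eq1 -big_split; apply: eq_bigr => x _; rewrite /crosses !inE /=.
  have := loopless e; case: ((en e).1 =P x) => [->|_]; case: ((en e).2 =P x) => [->|_] //=.
  by rewrite eqxx.
by rewrite /crosses; case: (_ \in A); case: (_ \in A).
Qed.

Lemma marked_ample (d p q : nat) (D : int) : (4 <= d)%N ->
  (d = 5 -> (0 < p + q)%N) -> (2 %| D - d%:Z)%Z ->
  ample (d + (p + q)) (q%:Z - p%:Z + 3 * D).
Proof. by rewrite /ample /dist6; clear; lia. Qed.

(** The first five marks receive an arc from the root and the last two send one to it.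
    The prescription is that the edges of the graph balance modulo 3; the
    multiple of 3 in the residue only adjusts the parity. *)
Lemma marked_valid (s : seq T) : size s = 7 ->
  (forall A : {set T}, A != set0 -> A != setT -> (4 <= cut en setT A)%N) ->
  (forall A, cut en setT A = 5 -> has (mem A) s) ->
  valid en setT setT (fun x => count_mem x (take 5 s)) (fun x => count_mem x (drop 5 s))
    (fun x => (count_mem x (drop 5 s))%:Z - (count_mem x (take 5 s))%:Z +
              3 * (cut en setT [set x])%:Z).
Proof.
move=> size_s cut4 hit.
pose p (A : {set T}) := count (mem A) (take 5 s); pose q (A : {set T}) := count (mem A) (drop 5 s).
have hc (A : {set T}) : (\sum_(x in A) (count_mem x (take 5 s) + count_mem x (drop 5 s)) = p A + q A)%N.
  by rewrite big_split /= !sum_count.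
have ht (A : {set T}) : \sum_(x in A) ((count_mem x (drop 5 s))%:Z - (count_mem x (take 5 s))%:Z +
              3 * (cut en setT [set x])%:Z) =
     (q A)%:Z - (p A)%:Z + 3 * (\sum_(x in A) cut en setT [set x])%N%:Z.
  by rewrite big_split /= sumrB -mulr_sumr -!sum_natz !sum_count.
have cutT : cut en setT setT = 0%N by apply: big1 => e _; rewrite /crosses !inE.
split.
- by move=> e _; rewrite !inE.
- rewrite (eq_bigr (fun x => 3 * (cut en setT [set x])%:Z)); last by move=> x _; ring.
  rewrite -mulr_sumr -sum_natz; have := handshake setT; rewrite cutT.
  by move: (\sum_(x in _) _)%N => k; clear; lia.
- move=> A A0 AT; rewrite hc ht; apply: marked_ample; last exact: handshake.
  + by apply: cut4 => //; move: AT; rewrite properT.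
  + by move=> /hit; rewrite has_count /p /q -count_cat cat_take_drop.
rewrite hc ht.
have -> : p setT = 5 by rewrite /p (eq_count (in_setT (T := T))) count_predT size_take size_s.
have -> : q setT = 2 by rewrite /q (eq_count (in_setT (T := T))) count_predT size_drop size_s.
have := handshake setT; rewrite cutT.
by move: (\sum_(x in _) _)%N => k; rewrite /dist6; clear; lia.
Qed.

End Weights.

Lemma flow_conservation (G : mgraph) (D : orientation G) (f : edge G -> int) v :
  \sum_(e in out_arcs D v) f e - \sum_(e in in_arcs D v) f e = excess (arc D) f v.
Proof.
rewrite /excess /net /inc big_mkcond [X in _ - X]big_mkcond [RHS]big_mkcond -sumrB.
apply: eq_bigr => e _; rewrite !inE mulrBr /arc /=.
by case: eqP; case: eqP; rewrite ?mulr1 ?mulr0.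
Qed.

Local Close Scope ring_scope.

Theorem theorem1p13 (G : mgraph) :
  edge_connected 4 G -> #|edge_cuts G 5| <= 7 -> nowhere_zero_3flow G.
Proof.
move=> conn le7; have [D] := orientation_exists G.
have [r _|no_vertex] := pickP (@predT (vertex G)); last first.
  by exists D, (fun=> 1%R); split=> // v; have := no_vertex v.
have [s0 size_s0 hit] := hitting_marks D r conn le7.
pose s := s0 ++ nseq (7 - size s0) r.
have size_s : size s = 7 by rewrite size_cat size_nseq subnKC.
have [||sg hsg hnet] := mod3_orientation (marked_valid (arc_loopless D) size_s _ _).
- by move=> A A0 AT; rewrite cut_boundary; apply: boundary_ge.
- by move=> A; rewrite cut_boundary has_cat => /hit ->.
have [e|x|f nzf hf] := integer_flow (arc_loopless D) (f := sg).
- by case: (hsg e) => ->.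
- have := hnet x (in_setT x); rewrite /excess; clear.
  by move: (net _ _ _ _) => n; lia.
exists D, f; split=> // v; apply/eqP; rewrite -subr_eq0.
by rewrite flow_conservation hf.
Qed.
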